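(* Let $f_i=\sum_{|\alpha|\le d_i}c_{i,\alpha}x^\alpha$, $i=1,\dots,n$, be generic polynomials in $x_1,\dots,x_n$ (the $c_{i,\alpha}$ indeterminates), let $\mathbb M$ be a set of $\mathbf d=d_1\cdots d_n$ monomials in $x_1,\dots,x_n$, $\delta=\delta(\mathbb M)$, and let $P_{\mathbb M,d_1,\dots,d_n}=\operatorname{Res}_{d_1,\dots,d_n}(f_{1d_1},\dots,f_{nd_n})\,\Delta^\delta_{\mathbb M_\delta}$, a polynomial in the $c_{i,\alpha}$. Suppose $P_{\mathbb M,d_1,\dots,d_n}$ is not identically zero. Then the following are equivalent: (i) $P_{\mathbb M,d_1,\dots,d_n}$ depends only on the coefficients of $f_{1d_1},\dots,f_{nd_n}$ (i.e. only on the $c_{i,\alpha}$ with $|\alpha|=d_i$); (ii) for every $t=0,1,\dots,\rho$, the number of monomials of $\mathbb M$ of degree exactly $t$ equals $h_{(d_1,\dots,d_n)}(t)$. Moreover, if these conditions hold, then (up to sign) $$\Delta^\delta_{\mathbb M_\delta}=\prod_{t=\min_i d_i}^{\rho}D^t_{\mathbb M\cap\mathbb K[x_1,\dots,x_n]_t},$$ where $D^t_S$ denotes the subresultant (in the $n$ variables $x_1,\dots,x_n$) of $S$ with respect to $f_{1d_1},\dots,f_{nd_n}$.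
   Context: $\rho=d_1+\dots+d_n-n$; $f_{id_i}$ is the degree-$d_i$ homogeneous component of $f_i$; $\operatorname{Res}$ is the Macaulay homogeneous resultant; $\delta(\mathbb M)=\max\{\deg m: m\in\mathbb M\}$; $f_i^0$ is the homogenization of $f_i$ with a new variable $x_0$; $\mathbb M_t=\{m\,x_0^{t-\deg m}:m\in\mathbb M\}$; $\Delta^\delta_{\mathbb M_\delta}$ is the subresultant of $\mathbb M_\delta$ with respect to $f_1^0,\dots,f_n^0$; $\mathbb K[x_1,\dots,x_n]_t$ is the space of homogeneous polynomials of degree $t$. The numbers $h_{(d_1,\dots,d_n)}(\tau)$ are defined by $\sum_{\tau\ge0}h_{(d_1,\dots,d_n)}(\tau)T^\tau=\prod_{j=1}^n(1-T^{d_j})/(1-T)^n$. Subresultants (Chardin): for homogeneous $P_1,\dots,P_s$ of degrees $d_i$ in $N$ variables with indeterminate coefficients, $t\ge0$ and a set $S$ of $H(t)$ monomials of degree $t$, where $\sum_\tau H(\tau)T^\tau=\prod_{j=1}^s(1-T^{d_j})/(1-T)^N$, $\Delta^t_S$ is the determinant (defined up to sign) of the degree-$t$ Koszul complex of $P_1,\dots,P_s$ in which the last map $\sum p_ie_i\mapsto\sum p_iP_i$ is followed by projection onto the span of the degree-$t$ monomials not in $S$, computed in monomial bases, if this complex is exact over the fraction field of the coefficient ring, and $0$ otherwise. It is a polynomial in the coefficients; it is nonzero at a specialization over a field $\mathbf k$ iff the degree-$t$ part of the ideal plus $\mathbf k\langle S\rangle$ is the whole degree-$t$ space. *)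

(* Defs.v *)
From HB Require Import structures.
From mathcomp Require Import all_boot all_order all_algebra.
From mathcomp Require Import fraction.
From mathcomp Require Export mpoly.
Set Implicit Arguments.
Unset Strict Implicit.
Unset Printing Implicit Defensive.
Import Order.TTheory GRing.Theory Num.Theory.
Local Open Scope ring_scope.

Definition mons (N t : nat) : seq 'X_{1..N} :=
  [seq val m | m <- enum [pred m : 'X_{1..N < t.+1} | mdeg (val m) == t]].

Definition mons_le (N t : nat) : seq 'X_{1..N} :=
  [seq val m | m <- enum [pred m : 'X_{1..N < t.+1} | true]].

(* Chardin's subresultant Delta^t_S of P_1..P_s (homogeneous of       *)
(* degrees e_1..e_s) in N variables, coefficients in a domain A.      *)
(* Degree-t Koszul complex  K_s -> ... -> K_1 -> K_0, where           *)
(*   K_j (j>=1) has monomial basis  e_I (x) m, |I| = j, deg m = t - e_I *)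
(*   K_0 has basis the degree-t monomials NOT in S (the last Koszul    *)
(*   map followed by the projection onto their span).                 *)
Section Subresultant.
Variables (A : idomainType) (N s : nat).
Variables (P : 'I_s -> {mpoly A[N]}) (e : 'I_s -> nat) (t : nat).
Variable (S : seq 'X_{1..N}).

Definition esum (I : {set 'I_s}) : nat := (\sum_(i in I) e i)%N.

Definition kbasis (j : nat) : seq ({set 'I_s} * 'X_{1..N}) :=
  if j is 0 then [seq (set0, m) | m <- mons N t & m \notin S]
  else flatten [seq [seq (J, m) | m <- mons N (t - esum J)]
               | J <- enum [pred J : {set 'I_s} | (#|J| == j) && (esum J <= t)%N]].

Definition kdim (j : nat) : nat := size (kbasis j).

Definition kb0 : {set 'I_s} * 'X_{1..N} := (set0, 0%MM).

(* entry of the Koszul differential K_j -> K_{j-1} (row = source basis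
   element a of K_j, column = target basis element b of K_{j-1});
   e_I (x) m  |->  sum_{i in I} (-1)^(pos of i in I) (P_i m) e_{I\i}.  *)
Definition kent (j a b : nat) : A :=
  let: (J, m) := nth kb0 (kbasis j) a in
  let: (J', m') := nth kb0 (kbasis j.-1) b in
  \sum_(i in J | J' == J :\ i) (-1) ^+ index i (enum J) * ('X_[m] * P i)@_m'.

(* the differential, as a matrix over the fraction field (row-vector
   convention: v |-> v *m kmx j); kmx 0 is the zero map K_0 -> K_0
   and K_{s+1} = 0. *)
Definition kmx (j : nat) : 'M[{fraction A}]_(kdim j, kdim j.-1) :=
  \matrix_(a < kdim j, b < kdim j.-1) tofrac (kent j a b).

Definition koszul_exact : Prop :=
  forall j, (j <= s)%N -> (kmx j.+1 == kermx (kmx j))%MS.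

(* Cayley's formula for the determinant of an exact based complex:
   sel j k says that basis vector k of K_j belongs to the rows selected
   for the map out of K_j; the others are the columns selected for the
   map into K_j. *)
Definition krows (sel : nat -> nat -> bool) (j : nat) : seq nat :=
  [seq k <- iota 0 (kdim j) | sel j k].
Definition kcols (sel : nat -> nat -> bool) (j : nat) : seq nat :=
  [seq k <- iota 0 (kdim j.-1) | ~~ sel j.-1 k].
Definition kminor (sel : nat -> nat -> bool) (j : nat) : A :=
  \det (\matrix_(a < size (krows sel j), b < size (krows sel j))
          kent j (nth 0%N (krows sel j) a) (nth 0%N (kcols sel j) b)).

Definition cayley_det (sel : nat -> nat -> bool) (D : A) : Prop :=
  [/\ krows sel 0 = [::],
      forall j, (1 <= j <= s.+1)%N ->
        size (krows sel j) = size (kcols sel j) /\ kminor sel j != 0 &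
      D * (\prod_(1 <= j < s.+2 | ~~ odd j) kminor sel j)
        = \prod_(1 <= j < s.+2 | odd j) kminor sel j].

(* D is (a representative, up to sign, of) the subresultant Delta^t_S *)
Definition is_subres (D : A) : Prop :=
  (koszul_exact /\ exists sel, cayley_det sel D) \/
  (~ koszul_exact /\ D = 0).

End Subresultant.

Section Generic.
Variables (K : fieldType) (n : nat) (d : 'I_n -> nat).

(* index set of the indeterminates c_{i,alpha}, |alpha| <= d_i
   (the index i is stored as a nat) *)
Definition cidx : seq (nat * 'X_{1..n}) :=
  flatten [seq [seq (val i, a) | a <- mons_le n (d i)] | i <- enum 'I_n].
Definition ncoef : nat := size cidx.
Definition cdef : nat * 'X_{1..n} := (0%N, 0%MM).
Definition cvar (k : 'I_ncoef) : nat * 'X_{1..n} := nth cdef cidx k.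

Definition CR := {mpoly K[ncoef]}.

Definition top_coef (k : 'I_ncoef) : bool :=
  [exists i : 'I_n, ((cvar k).1 == val i) && (mdeg (cvar k).2 == d i)].

Definition fgen (i : 'I_n) : {mpoly CR[n]} :=
  \sum_(k < ncoef | (cvar k).1 == val i) ('X_k : CR) *: 'X_[(cvar k).2].

Definition ftop (i : 'I_n) : {mpoly CR[n]} :=
  \sum_(k < ncoef | ((cvar k).1 == val i) && (mdeg (cvar k).2 == d i))
     ('X_k : CR) *: 'X_[(cvar k).2].

(* homogenization of a monomial to degree e with the new variable x_0,
   which is variable number 0 of 'X_{1..n.+1}; x_j is variable j *)
Definition homog_mon (e : nat) (m : 'X_{1..n}) : 'X_{1..n.+1} :=
  [multinom (if unlift ord0 i is Some j then m j else e - mdeg m)%N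
  | i < n.+1].

Definition fhom (i : 'I_n) : {mpoly CR[n.+1]} :=
  \sum_(k < ncoef | (cvar k).1 == val i)
     ('X_k : CR) *: 'X_[homog_mon (d i) (cvar k).2].

Definition depends_only_on_top (p : CR) : Prop :=
  forall m, m \in msupp p -> forall k : 'I_ncoef, ~~ top_coef k -> m k = 0%N.

Definition rho : nat := ((\sum_(i < n) d i) - n)%N.

(* h_{(d_1..d_n)}(tau): coefficient of T^tau in
   prod_j (1 - T^{d_j})/(1 - T) = prod_j (1 + T + ... + T^{d_j - 1}) *)
Definition hnum (tau : nat) : int :=
  (\prod_(j < n) \sum_(k < d j) ('X^k : {poly int}))`_tau.

End Generic.

Definition deltaM (n : nat) (M : seq 'X_{1..n}) : nat := (\max_(m <- M) mdeg m)%N.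

(* Main.v *)
(* Dehomogenizing, a monomial of degree delta in x_0, ..., x_n is a monomial of
   degree <= delta in x_1, ..., x_n, and the degree-delta Koszul complex of the
   f_i^0 is filtered by the degree in x_1, ..., x_n, with the degree-t Koszul
   complexes of the f_{id_i} as graded pieces.  Specializing f_i to x_i^{d_i}
   yields an explicit choice of nonzero minors, homogeneous for this grading, for
   all Koszul maps but the last.  Since the Cayley determinant of an exact complex
   does not depend, up to sign, on the chosen minors, Delta can be computed from
   these; those in degrees j >= 2 are block triangular, and involve only the top
   coefficients.

   If the numbers of monomials are those of (ii), the minor of the last map is
   block triangular with square blocks as well, so Delta is the product of the
   D^t.  Conversely, if Delta involves only the top coefficients then so does this
   last minor, which is thus unchanged when the lower coefficients vanish; its
   matrix is then block diagonal, and being invertible has square blocks: this is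
   the equality of cardinalities (ii). *)

Require Import Defs.
From HB Require Import structures.
From mathcomp Require Import all_boot all_order all_algebra all_fingroup.
From mathcomp Require Import fraction mpoly zify.
Set Implicit Arguments.
Unset Strict Implicit.
Unset Printing Implicit Defensive.
Import Order.TTheory GRing.Theory Num.Theory.
Local Open Scope ring_scope.

(** * Determinants indexed by lists *)

Section EqSign.
Variable R : comPzRingType.
Implicit Types a b c : R.

(** A boolean exponent instead of a disjunction: signs compose by [addb], and a permutation is a
    witness through its parity. *)
Definition eq_sign a b := exists e : bool, a = (-1) ^+ e * b.

Lemma eq_sign_refl a : eq_sign a a.
Proof. by exists false; rewrite mul1r. Qed.

Lemma eq_sign_sym a b : eq_sign a b -> eq_sign b a.
Proof. by case=> e ->; exists e; rewrite signrMK. Qed.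

Lemma eq_sign_trans b a c : eq_sign a b -> eq_sign b c -> eq_sign a c.
Proof.
case=> e -> [e' ->]; exists (e (+) e'); by rewrite signr_addb mulrA.
Qed.

Lemma eq_signM a a' b b' :
  eq_sign a a' -> eq_sign b b' -> eq_sign (a * b) (a' * b').
Proof.
case=> e -> [e' ->]; exists (e (+) e').
by rewrite signr_addb mulrACA.
Qed.

Lemma eq_sign_prod (I : Type) (r : seq I) (P : pred I) (F G : I -> R) :
  (forall i, P i -> eq_sign (F i) (G i)) ->
  eq_sign (\prod_(i <- r | P i) F i) (\prod_(i <- r | P i) G i).
Proof.
move=> FG; elim/big_ind2: _; [exact: eq_sign_refl | | exact: FG].
by move=> *; apply: eq_signM.
Qed.

Lemma eq_sign_eq0 a b : eq_sign a b -> (a == 0) = (b == 0).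
Proof.
case=> e ->; apply/eqP/eqP => [|->]; last by rewrite mulr0.
by move/(congr1 ( *%R ((-1) ^+ e))); rewrite signrMK mulr0.
Qed.

Lemma eq_signP a b : eq_sign a b -> a = b \/ a = - b.
Proof.
by case=> -[] ->; [right; rewrite expr1 mulN1r | left; rewrite mul1r].
Qed.

End EqSign.

Lemma eq_sign_mulIf (R : idomainType) (x a b : R) :
  x != 0 -> eq_sign (a * x) (b * x) -> eq_sign a b.
Proof. by move=> x0 [e]; rewrite mulrA => /(mulIf x0) ->; exists e. Qed.

Section ListDeterminant.
Variables (R : comPzRingType) (T : eqType) (x0 : T).
Implicit Types (E : T -> T -> R) (r c : seq T).

(** The size is a separate argument, so lists of provably equal length can be exchanged without
    casts; the default [x0] is read only beyond the end of a list. *)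
Definition sdet n E r c :=
  \det (\matrix_(a < n, b < n) E (nth x0 r a) (nth x0 c b)).

Lemma sdet_tr n E r c : sdet n E r c = sdet n (fun x y => E y x) c r.
Proof. by rewrite /sdet -det_tr; congr (\det _); apply/matrixP=> i j; rewrite !mxE. Qed.

Lemma sdet_perml n E r r' c :
  size r = n -> perm_eq r r' -> eq_sign (sdet n E r c) (sdet n E r' c).
Proof.
move=> szr rr'; have szr' : size r' == n by rewrite -(perm_size rr') szr.
have /tuple_permP[p rE] : perm_eq r (Tuple szr') by [].
exists p; rewrite /sdet -det_perm -det_mulmx -row_permE.
congr (\det _); apply/matrixP=> i j; rewrite !mxE; congr (E _ _).
by rewrite rE -(tnth_nth x0 [tuple _ | _ < _]) tnth_mktuple (tnth_nth x0).
Qed.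

Lemma sdet_perm n E r r' c c' :
    size r = n -> size c = n -> perm_eq r r' -> perm_eq c c' ->
  eq_sign (sdet n E r c) (sdet n E r' c').
Proof.
move=> szr szc rr' cc'; apply: eq_sign_trans (sdet_perml _ _ szr rr') _.
by rewrite sdet_tr (sdet_tr _ _ r'); apply: sdet_perml.
Qed.

Lemma eq_in_sdet n E E' r c : size r = n -> size c = n ->
    {in r & c, forall x y, E x y = E' x y} ->
  sdet n E r c = sdet n E' r c.
Proof.
move=> szr szc EE'; congr (\det _); apply/matrixP=> i j; rewrite !mxE.
by apply: EE'; rewrite mem_nth ?szr ?szc.
Qed.

Lemma sdet_cat E p q r1 r2 c1 c2 :
    size r1 = p -> size c1 = p -> size r2 = q -> size c2 = q ->
    {in r1 & c2, forall x y, E x y = 0} ->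
  sdet (p + q) E (r1 ++ r2) (c1 ++ c2) = sdet p E r1 c1 * sdet q E r2 c2.
Proof.
move=> szr1 szc1 szr2 szc2 E0; rewrite /sdet.
rewrite -(det_lblock _ (\matrix_(a < q, b < p) E (nth x0 r2 a) (nth x0 c1 b))).
congr (\det _); apply/matrixP=> i j; rewrite !mxE.
case: (splitP i) => i' ->; rewrite !mxE; case: (splitP j) => j' -> /=;
  rewrite ?mxE !nth_cat szr1 szc1 ?ltn_ord //=;
  rewrite ?[(p + _ < p)%N]ltnNge ?leq_addr /= ?addKn //.
by apply: E0; rewrite mem_nth ?szr1 ?szc2.
Qed.

(** Entries to the right of the diagonal blocks vanish, so the matrix is block lower triangular; the
    first block is split off by [sdet_cat]. *)
Lemma sdet_flatten E (r c : nat -> seq T) m k :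
    (forall t, (m <= t < m + k)%N -> size (r t) = size (c t)) ->
    (forall t t', (m <= t < t')%N -> (t' < m + k)%N ->
       {in r t & c t', forall x y, E x y = 0}) ->
  sdet (size (flatten [seq r t | t <- iota m k])) E
       (flatten [seq r t | t <- iota m k]) (flatten [seq c t | t <- iota m k])
  = \prod_(t <- iota m k) sdet (size (r t)) E (r t) (c t).
Proof.
elim: k m => [|k IH] m szrc E0; first by rewrite big_nil /sdet /= det_mx00.
have ss t : (m.+1 <= t < m.+1 + k)%N -> (m <= t < m + k.+1)%N by lia.
rewrite big_cons /= size_cat sdet_cat //.
- rewrite IH // => [t /ss|t t' tt' t'k]; first exact: szrc.
  by apply: E0; lia.
- by rewrite -szrc // leqnn addnS ltnS leq_addr.
- rewrite !size_flatten /shape -!map_comp; congr sumn; apply/esym/eq_in_map.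
  by move=> t; rewrite mem_iota => /ss; apply: szrc.
- move=> x y xr /flattenP[s /mapP[t' t'b sE]]; rewrite {s}sE => yc.
  by apply: (E0 m t' _ _ x y xr yc); move: t'b; rewrite mem_iota; lia.
Qed.

End ListDeterminant.

Lemma sdet_map (R : comPzRingType) (T U : eqType) (x0 : T) (y0 : U) (h : T -> U)
    n (E : U -> U -> R) (r c : seq T) : size r = n -> size c = n ->
  sdet y0 n E (map h r) (map h c) = sdet x0 n (fun x y => E (h x) (h y)) r c.
Proof.
move=> szr szc; congr (\det _); apply/matrixP=> i j; rewrite !mxE.
by rewrite !(nth_map x0) ?szr ?szc.
Qed.

Lemma sdet_rmorph (R S : comPzRingType) (f : {rmorphism R -> S}) (T : eqType)
    (x0 : T) n (E : T -> T -> R) r c :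
  f (sdet x0 n E r c) = sdet x0 n (fun x y => f (E x y)) r c.
Proof. by rewrite -det_map_mx; congr (\det _); apply/matrixP=> i j; rewrite !mxE. Qed.

(** Rows of an invertible matrix are independent; those in [p] are supported on the columns in [q],
    so there are at most as many. Ranks are taken over the fraction field. *)
Lemma sdet_neq0_count (R : idomainType) (T : eqType) (x0 : T) n
    (E : T -> T -> R) (r c : seq T) (p q : pred T) :
    size r = n -> size c = n -> sdet x0 n E r c != 0 ->
    {in r & c, forall x y, p x -> ~~ q y -> E x y = 0} ->
  (count p r <= count q c)%N.
Proof.
move=> szr szc; rewrite -tofrac_eq0 (sdet_rmorph (@tofrac R)) => det0 E0.
pose M := (\matrix_(a < n, b < n)
  tofrac (E (nth x0 r a) (nth x0 c b)) : 'M[{fraction R}]_n).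
have : row_free M by rewrite row_free_unit unitmxE unitfE.
pose f (x : 'I_(count p r)) := nth 0%N [seq i <- iota 0 n | p (nth x0 r i)] x.
have szp : size [seq i <- iota 0 n | p (nth x0 r i)] = count p r.
  by rewrite size_filter -(count_map (nth x0 r) p) -szr -/(mkseq _ _) mkseq_nth.
pose g (x : 'I_(count q c)) := nth 0%N [seq i <- iota 0 n | q (nth x0 c i)] x.
have szq : size [seq i <- iota 0 n | q (nth x0 c i)] = count q c.
  by rewrite size_filter -(count_map (nth x0 c) q) -szc -/(mkseq _ _) mkseq_nth.
have fP x : (f x < n)%N && p (nth x0 r (f x)).
  have : f x \in [seq i <- iota 0 n | p (nth x0 r i)] by rewrite mem_nth ?szp.
  by rewrite mem_filter mem_iota add0n andbC.
have gP x : (g x < n)%N && q (nth x0 c (g x)).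
  have : g x \in [seq i <- iota 0 n | q (nth x0 c i)] by rewrite mem_nth ?szq.
  by rewrite mem_filter mem_iota add0n andbC.
pose fo x := Ordinal (proj1 (andP (fP x))).
pose go x := Ordinal (proj1 (andP (gP x))).
have fo_inj : injective fo.
  move=> x y /(congr1 val) /= /eqP; rewrite nth_uniq ?szp ?filter_uniq ?iota_uniq //.
  by move/eqP/val_inj.
have go_inj : injective go.
  move=> x y /(congr1 val) /= /eqP; rewrite nth_uniq ?szq ?filter_uniq ?iota_uniq //.
  by move/eqP/val_inj.
move=> Mfree; have /row_freeP[M' MM'] := Mfree.
have Nfree : row_free (rowsub fo M).
  apply/row_freeP; exists (colsub fo M').
  by rewrite -mxsub_mul MM'; apply/matrixP=> i j; rewrite !mxE (inj_eq fo_inj).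
rewrite /row_free in Nfree; rewrite -{1}(eqP Nfree).
(* The selected rows are recovered from their columns in [q] by inserting zeros, so their rank is at
   most the number of such columns. *)
suff -> : rowsub fo M = colsub go (rowsub fo M) *m rowsub go 1%:M.
  by apply: leq_trans (mxrankM_maxl _ _) (rank_leq_col _).
apply/matrixP=> i j; rewrite !mxE.
have [qj|qj] := boolP (q (nth x0 c j)).
  have jq : (j : nat) \in [seq i <- iota 0 n | q (nth x0 c i)].
    by rewrite mem_filter qj mem_iota add0n ltn_ord.
  have ij : (index (j : nat) [seq i <- iota 0 n | q (nth x0 c i)] < count q c)%N.
    by rewrite -szq index_mem.
  have gj : go (Ordinal ij) = j by apply: val_inj; rewrite /= /g /= nth_index.
  rewrite (bigD1 (Ordinal ij)) //= !mxE gj eqxx mulr1 big1 ?addr0 // => k kj.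
  by rewrite !mxE (_ : (go k == j) = false) ?mulr0 // -gj (inj_eq go_inj) (negbTE kj).
rewrite E0 ?mem_nth ?szr ?szc ?(andP (fP _)).1 ?(andP (fP _)).2 // big1 ?tofrac0 // => k _.
rewrite !mxE (_ : (go k == j) = false) ?mulr0 //.
by apply: contraNF qj => /eqP <-; case/andP: (gP k).
Qed.

(** * Independence of the Cayley determinant from the selection *)

Section NatIndexedMatrix.
Variable F : fieldType.

Definition nat_entry m n (M : 'M[F]_(m, n)) (a b : nat) : F :=
  if insub a is Some i then if insub b is Some j then M i j else 0 else 0.

Lemma nat_entryE m n (M : 'M[F]_(m, n)) (i : 'I_m) (j : 'I_n) :
  nat_entry M i j = M i j.
Proof. by rewrite /nat_entry !valK. Qed.

Lemma nat_entryM m n p (M : 'M[F]_(m, n)) (M' : 'M[F]_(n, p)) a b :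
  nat_entry (M *m M') a b = \sum_(l < n) nat_entry M a l * nat_entry M' l b.
Proof.
rewrite /nat_entry; case: insubP => [i _ _|_]; last first.
  by rewrite big1 // => l _; rewrite mul0r.
case: insubP => [j _ _|_]; last first.
  by rewrite big1 // => l _; rewrite valK mulr0.
by rewrite mxE; apply: eq_bigr => l _; rewrite valK.
Qed.

(* The Pluecker coordinates of the row space of [R] and those of its
   orthogonal, the column space of [L], agree up to sign and scaling. *)
Lemma complementary_minors k p q (L : 'M[F]_(k, p)) (R : 'M[F]_(q, k)) :
    (p + q)%N = k -> R *m L = 0 -> row_free R ->
  exists lam : F, forall r c : seq nat,
    size r = p -> size c = q -> perm_eq (r ++ c) (iota 0 k) ->
  eq_sign (\det (\matrix_(a < p, l < p) nat_entry L (nth 0%N r a) l))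
      (lam * \det (\matrix_(l < q, b < q) nat_entry R l (nth 0%N c b))).
Proof.
move=> kE; case: k / kE L R => L R RL /row_freeP[X RX].
(* [X] is a right inverse of [R], so [R *m W] is the block row [0, 1]. The scalar is [\det W],
   whatever [r] and [c]. *)
pose W := row_mx L X; exists (\det W) => r c szr szc rc.
have rcP (i : 'I_(p + q)) : (nth 0%N (r ++ c) i < p + q)%N.
  have : nth 0%N (r ++ c) i \in iota 0 (p + q).
    by rewrite -(perm_mem rc) mem_nth // size_cat szr szc.
  by rewrite mem_iota.
pose h i := Ordinal (rcP i).
have h_inj : injective h.
  move=> i j /(congr1 val) /= /eqP; rewrite nth_uniq ?size_cat ?szr ?szc //.
    by move/eqP/val_inj.
  by rewrite (perm_uniq rc) iota_uniq.
pose f a := h (lshift q a); pose g b := h (rshift p b).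
have -> : \matrix_(a < p, l < p) nat_entry L (nth 0%N r a) l = rowsub f L.
  apply/matrixP=> a l; rewrite !mxE -nat_entryE /=.
  by rewrite nth_cat szr ltn_ord.
have -> : \matrix_(l < q, b < q) nat_entry R l (nth 0%N c b) = colsub g R.
  apply/matrixP=> l b; rewrite !mxE -nat_entryE /=.
  by rewrite nth_cat szr ltnNge leq_addr /= addKn.
(* The rows of [W] are put in the order [r ++ c]. The left side has the minor of [L] as determinant,
   the right side the minor of [R] times [\det W], up to the sign of the reordering. *)
have WE : block_mx (rowsub f L) (rowsub f X) 0 1%:M
        = block_mx 1%:M 0 (colsub (h \o lshift q) R) (colsub g R) *m rowsub h W.
  have -> : block_mx 1%:M 0 (colsub (h \o lshift q) R) (colsub g R)
            = col_mx (rowsub (lshift q) 1%:M) (colsub h R).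
    apply/matrixP=> i j; rewrite !mxE; case: (split i) => i'; rewrite !mxE;
      rewrite -[j in RHS]splitK; case: (split j) => j'; rewrite /= ?mxE //.
    by rewrite eq_lrshift.
  rewrite mul_col_mx mul_rowsub_mx mul1mx.
  have -> : colsub h R *m rowsub h W = R *m W.
    apply/matrixP=> i j; rewrite !mxE.
    by rewrite [RHS](reindex_inj h_inj); apply: eq_bigr => l _; rewrite !mxE.
  rewrite mul_mx_row RL RX; apply/matrixP=> i j; rewrite !mxE.
  by case: (split i) => i'; rewrite !mxE; case: (split j) => j'; rewrite ?mxE.
have hW : rowsub h W = row_perm (perm h_inj) W.
  by apply/matrixP=> i j; rewrite !mxE permE.
move/(congr1 determinant): WE.
rewrite det_ublock det1 mulr1 det_mulmx det_lblock det1 mul1r hW row_permE.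
rewrite det_mulmx det_perm => ->; exists (perm h_inj : bool).
by rewrite mulrCA; congr (_ * _); rewrite mulrC.
Qed.

End NatIndexedMatrix.

Lemma kmx0 (A : idomainType) (N s : nat) (P : 'I_s -> {mpoly A[N]}) e t S :
  kmx P e t S 0 = 0.
Proof.
apply/matrixP=> a b; rewrite !mxE /kent /=.
set x := nth _ _ _; have /mapP[m _ ->] : x \in kbasis e t S 0 by rewrite mem_nth.
by case: (nth _ _ _) => J' m'; rewrite big1 ?tofrac0 // => i; rewrite inE.
Qed.

Section CayleyDeterminant.
Variables (A : idomainType) (N s : nat).
Variables (P : 'I_s -> {mpoly A[N]}) (e : 'I_s -> nat) (t : nat).
Variable (S : seq 'X_{1..N}).
Hypothesis exactP : koszul_exact P e t S.
Implicit Type sel : nat -> nat -> bool.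

Local Notation kdim := (kdim e t S).
Local Notation kmx := (kmx P e t S).
Local Notation krows := (krows e t S).
Local Notation kcols := (kcols e t S).
Local Notation kminor := (kminor P e t S).
Local Notation rk j := (\rank (kmx j)).

Lemma kdim_gt j : (s < j)%N -> kdim j = 0%N.
Proof.
case: j => // j sj; rewrite /Defs.kdim /kbasis.
rewrite (eq_enum (_ : _ =1 pred0)) ?enum0 // => J.
apply/negbTE; apply/negP => /andP[/eqP Jj _].
by have := max_card (mem J); rewrite Jj card_ord; lia.
Qed.

Lemma kmx_exact j : (kmx j.+1 == kermx (kmx j))%MS.
Proof.
have [/exactP //|/kdim_gt k0] := leqP j s.
have z m (M : 'M[{fraction A}]_(m, kdim j)) : M = 0.
  by apply/eqP; rewrite -mxrank_eq0 -leqn0 -k0 rank_leq_col.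
by rewrite (z _ (kmx j.+1)) (z _ (kermx _)) !sub0mx.
Qed.

Lemma rank_kmxS j : (rk j + rk j.+1 = kdim j)%N.
Proof.
rewrite (eqmx_rank (kmx_exact j)) mxrank_ker subnKC //.
exact: rank_leq_row.
Qed.

Lemma size_krows_cols sel j :
  (size (krows sel j) + size (kcols sel j.+1) = kdim j)%N.
Proof. by rewrite !size_filter count_predC size_iota. Qed.

(** Descending induction from [K_(s+1) = 0]: in each degree the selected rows and the remaining
    basis vectors add up to [kdim j], as do the two ranks. Squareness is assumed from degree 2 on,
    so that [subres_pivot] can deduce it in degree 1. *)
Lemma rank_kmx sel j : (0 < j <= s.+1)%N ->
    (forall i, (1 < i <= s.+1)%N -> size (krows sel i) = size (kcols sel i)) ->
  size (krows sel j) = rk j.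
Proof.
move=> /andP[j0 js] szE; move: j0 (subnKC js); move: (s.+1 - j)%N => m {js}.
elim: m j => [|m IH] j j0 jm.
  rewrite addn0 in jm; have k0 : kdim j = 0%N by rewrite kdim_gt ?jm.
  have := size_krows_cols sel j; have := rank_leq_row (kmx j).
  by move=> h1 h2; apply/eqP; lia.
have := IH j.+1 isT; rewrite addSnnS => /(_ jm) rE.
have := size_krows_cols sel j; have := rank_kmxS j; rewrite -szE ?rE; lia.
Qed.

Definition row_minor sel j :=
  \det (\matrix_(a < rk j, l < rk j)
     nat_entry (col_base (kmx j)) (nth 0%N (krows sel j) a) l).

(** The index is shifted so that [row_minor sel j] and [col_minor sel j] use complementary parts of
    the basis of [K_j]. *)
Definition col_minor sel j :=
  \det (\matrix_(l < rk j.+1, b < rk j.+1)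
     nat_entry (row_base (kmx j.+1)) l (nth 0%N (kcols sel j.+1) b)).

Lemma kminorE sel j : size (krows sel j.+1) = rk j.+1 ->
    size (kcols sel j.+1) = rk j.+1 ->
  tofrac (kminor sel j.+1) = row_minor sel j.+1 * col_minor sel j.
Proof.
move=> szr szc; rewrite /Defs.kminor szr -det_map_mx -det_mulmx.
congr (\det _); apply/matrixP=> a b; rewrite !mxE.
under eq_bigr do rewrite !mxE.
rewrite -nat_entryM mulmx_base.
have ra : (nth 0%N (krows sel j.+1) a < kdim j.+1)%N.
  have : nth 0%N (krows sel j.+1) a \in krows sel j.+1 by rewrite mem_nth ?szr.
  by rewrite mem_filter mem_iota => /andP[].
have rb : (nth 0%N (kcols sel j.+1) b < kdim j)%N.
  have : nth 0%N (kcols sel j.+1) b \in kcols sel j.+1 by rewrite mem_nth ?szc.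
  by rewrite mem_filter mem_iota => /andP[].
by rewrite -[nth _ _ a]/(val (Ordinal ra)) -[nth _ _ b]/(val (Ordinal rb)) nat_entryE mxE.
Qed.

(** By exactness the row space of [kmx j.+1] is the left kernel of [kmx j], so
    [complementary_minors] applies. The scalar is the same for all selections, which lets it cancel
    between two of them. *)
Lemma row_col_minor j : exists lam, forall sel,
    size (krows sel j) = rk j -> size (kcols sel j.+1) = rk j.+1 ->
  eq_sign (row_minor sel j) (lam * col_minor sel j).
Proof.
have RL : row_base (kmx j.+1) *m col_base (kmx j) = 0.
  have := eqmxP (kmx_exact j) => ee.
  have : (row_base (kmx j.+1) <= kermx (kmx j))%MS by rewrite eq_row_base ee.
  move/sub_kermxP => h0.
  have h : row_base (kmx j.+1) *m col_base (kmx j) *m row_base (kmx j) = 0.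
    by rewrite -mulmxA mulmx_base.
  have /row_freeP[Y RY] := row_base_free (kmx j).
  by have := congr1 (mulmx^~ Y) h; rewrite /= -mulmxA RY mulmx1 mul0mx.
have [lam lamP] := complementary_minors (rank_kmxS j) RL (row_base_free _).
exists lam => sel szr szc; apply: lamP => //.
by rewrite perm_filterC.
Qed.

(* Each minor is the product of a row and a column minor of the factors of a
   rank factorization; in the alternating product these cancel in consecutive
   degrees, by [row_col_minor]. *)
Lemma cayley_indep sel sel' :
    krows sel 0 = [::] -> krows sel' 0 = [::] ->
    (forall i, (1 < i <= s.+1)%N -> size (krows sel i) = size (kcols sel i)) ->
    (forall i, (1 < i <= s.+1)%N -> size (krows sel' i) = size (kcols sel' i)) ->
  eq_sign ((\prod_(1 <= j < s.+2 | odd j) kminor sel j)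
           * (\prod_(1 <= j < s.+2 | ~~ odd j) kminor sel' j))
          ((\prod_(1 <= j < s.+2 | odd j) kminor sel' j)
           * (\prod_(1 <= j < s.+2 | ~~ odd j) kminor sel j)).
Proof.
move=> r0 r0' szE szE'.
have szr sl j : krows sl 0 = [::] ->
    (forall i, (1 < i <= s.+1)%N -> size (krows sl i) = size (kcols sl i)) ->
    (j <= s.+1)%N -> size (krows sl j) = rk j.
  by case: j => [|j] sl0 slE js; [rewrite sl0 kmx0 mxrank0 | apply: rank_kmx].
have szc sl j : krows sl 0 = [::] ->
    (forall i, (1 < i <= s.+1)%N -> size (krows sl i) = size (kcols sl i)) ->
    (j <= s.+1)%N -> size (kcols sl j.+1) = rk j.+1.
  move=> sl0 slE js; have := size_krows_cols sl j.
  by rewrite (szr _ _ sl0 slE js); have := rank_kmxS j; lia.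
pose m sl j : {fraction A} := tofrac (kminor sl j).
(* To balance the products truncated at [k], each side needs one column minor on [K_k]; the parity
   of [k] decides from which selection it comes. *)
pose X k := if odd k then col_minor sel' k else col_minor sel k.
pose X' k := if odd k then col_minor sel k else col_minor sel' k.
have claim k : (k <= s.+1)%N ->
    eq_sign ((\prod_(1 <= j < k.+1) (if odd j then m sel j else m sel' j)) * X k)
            ((\prod_(1 <= j < k.+1) (if odd j then m sel' j else m sel j)) * X' k).
  elim: k => [|k IH] ks.
    rewrite !big_geq // !mul1r /X /X' /col_minor /Defs.kcols /=.
    (* Nothing is selected in degree 0, so both column minors on [K_0] use the whole basis. *)
    have E sl : krows sl 0 = [::] ->
        [seq k <- iota 0 (kdim 0) | ~~ sl 0 k] = iota 0 (kdim 0).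
      move=> sl0; rewrite -[RHS](filter_predT); apply: eq_in_filter => i ib.
      apply: contra_eqN sl0 => sli; apply/eqP => sl0.
      by have := mem_filter (sl 0) i (iota 0 (kdim 0)); rewrite sli ib -/(krows sl 0) sl0.
    rewrite !E //; exact: eq_sign_refl.
  have [lam lamP] := row_col_minor k.+1.
  have cross : eq_sign (row_minor sel k.+1 * col_minor sel' k.+1)
                       (row_minor sel' k.+1 * col_minor sel k.+1).
    have h := lamP sel (szr _ _ r0 szE ks) (szc _ _ r0 szE ks).
    have h' := lamP sel' (szr _ _ r0' szE' ks) (szc _ _ r0' szE' ks).
    apply: (eq_sign_trans (eq_signM h (eq_sign_refl _))).
    apply: eq_sign_sym; apply: (eq_sign_trans (eq_signM h' (eq_sign_refl _))).
    by rewrite mulrAC; apply: eq_sign_refl.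
  have mE sl : krows sl 0 = [::] ->
      (forall i, (1 < i <= s.+1)%N -> size (krows sl i) = size (kcols sl i)) ->
      m sl k.+1 = row_minor sl k.+1 * col_minor sl k.
    move=> sl0 slE; apply: kminorE; first exact: szr.
    by apply: szc => //; apply: ltnW.
  rewrite !(big_nat_recr k.+1) //= !mE //.
  move: (IH (ltnW ks)); rewrite /X /X' /=; case: (odd k) => /= IHk.
    rewrite [_ * col_minor sel' k]mulrC [_ * col_minor sel k]mulrC !mulrA.
    rewrite -2!(mulrA (_ * _)).
    by apply: eq_signM => //; apply: eq_sign_sym.
  rewrite [_ * col_minor sel' k]mulrC [_ * col_minor sel k]mulrC !mulrA.
  rewrite -2!(mulrA (_ * _)).
  exact: eq_signM.
have X1 sl : col_minor sl s.+1 = 1.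
  rewrite /col_minor; move: (nat_entry _) (kcols _ _).
  have -> : rk s.+2 = 0%N.
    by apply/eqP; rewrite -leqn0 -(kdim_gt (ltnW (ltnSn s.+1))) rank_leq_row.
  by move=> *; rewrite det_mx00.
move: (claim s.+1 (leqnn _)); rewrite /X /X' !X1 !if_same !mulr1.
set G := (X in eq_sign X _); set G' := (X in eq_sign _ X).
have GE (sl sl' : nat -> nat -> bool) :
    (\prod_(1 <= j < s.+2) (if odd j then m sl j else m sl' j))
    = tofrac ((\prod_(1 <= j < s.+2 | odd j) kminor sl j)
           * (\prod_(1 <= j < s.+2 | ~~ odd j) kminor sl' j)).
  rewrite rmorphM !rmorph_prod [X in _ = X * _]big_mkcond.
  rewrite [X in _ = _ * X]big_mkcond -big_split /=.
  by apply: eq_bigr => j _; case: (odd j); rewrite ?mulr1 ?mul1r.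
rewrite /G /G' !GE => -[b /eqP].
rewrite -(rmorph_sign (@tofrac A)) -rmorphM tofrac_eq => /eqP ->.
by exists b.
Qed.

End CayleyDeterminant.

(** * Selections given by a predicate on the Koszul basis *)

Section KoszulBasis.
Variables (N s : nat) (e : 'I_s -> nat).
Implicit Type x : {set 'I_s} * 'X_{1..N}.

Lemma mem_mons t (m : 'X_{1..N}) : (m \in mons N t) = (mdeg m == t).
Proof.
apply/mapP/idP=> [[m' ] | mt]; first by rewrite mem_enum => h ->.
have mb : (mdeg m < t.+1)%N by rewrite (eqP mt).
by exists (BMultinom mb); rewrite ?mem_enum.
Qed.

Lemma uniq_mons t : uniq (mons N t).
Proof. by rewrite map_inj_uniq ?enum_uniq //; apply: val_inj. Qed.

Lemma mem_kbasis t S j x : (x \in kbasis e t S j) =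
  [&& #|x.1| == j, esum e x.1 + mdeg x.2 == t & (j == 0) ==> (x.2 \notin S)]%N.
Proof.
case: x j => J m [|j] /=.
  apply/mapP/and3P => [[m']|].
    rewrite mem_filter mem_mons => /andP[mS mt] [-> ->].
    by rewrite cards0 /esum big_set0.
  rewrite cards_eq0 => -[/eqP ->]; rewrite /esum big_set0 => mt mS.
  by exists m => //; rewrite mem_filter mem_mons mt mS.
apply/flatten_mapP/andP => [[J']|[Jj /andP[/eqP Jt _]]].
  rewrite mem_enum => /andP[Jj Jt] /mapP[m']; rewrite mem_mons => /eqP mt [-> ->].
  by rewrite Jj mt subnKC ?eqxx.
exists J; first by rewrite mem_enum; apply/andP; split=> //; rewrite -Jt leq_addr.
by apply/mapP; exists m => //; rewrite mem_mons -Jt addKn.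
Qed.

Lemma uniq_kbasis t S j : uniq (kbasis (N := N) e t S j).
Proof.
case: j => [|j] /=.
  by rewrite map_inj_uniq ?filter_uniq ?uniq_mons // => m m' [].
apply: (@allpairs_uniq_dep _ (fun=> _) _ (fun J m => (J, m))).
- exact: enum_uniq.
- by move=> J _; apply: uniq_mons.
- by move=> [J m] [J' m'] _ _ /= [-> ->].
Qed.

End KoszulBasis.

Section KoszulEntry.
Variables (A : idomainType) (N s : nat).
Variables (P : 'I_s -> {mpoly A[N]}) (e : 'I_s -> nat).
Implicit Types (x y : {set 'I_s} * 'X_{1..N}) (p : pred ({set 'I_s} * 'X_{1..N})).

Definition koszul_entry x y : A :=
  \sum_(i in x.1 | y.1 == x.1 :\ i)
     (-1) ^+ index i (enum x.1) * ('X_[x.2] * P i)@_y.2.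

Lemma kentE t S j a b : kent P e t S j a b =
  koszul_entry (nth (kb0 N s) (kbasis e t S j) a)
               (nth (kb0 N s) (kbasis e t S j.-1) b).
Proof. by rewrite /kent; case: nth => J m; case: nth. Qed.

Definition pivots p t S j := [seq x <- kbasis e t S j | p x].
(** In degree 0 every basis element is a target, whatever [p], since the map out of [K_0] is
    zero. *)
Definition targets p t S j :=
  [seq x <- kbasis e t S j | ~~ ((0 < j)%N && p x)].
Definition pivot_minor p t S j :=
  sdet (kb0 N s) (size (pivots p t S j.+1)) koszul_entry
       (pivots p t S j.+1) (targets p t S j).

Section Selection.
Variables (p : pred ({set 'I_s} * 'X_{1..N})) (t : nat) (S : seq 'X_{1..N}).

Definition pivot_sel j k := (0 < j)%N && p (nth (kb0 N s) (kbasis e t S j) k).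

Lemma krows_pivot0 : krows e t S pivot_sel 0 = [::].
Proof. by rewrite /krows -[RHS](filter_pred0 (iota 0 (kdim e t S 0))). Qed.

Lemma krows_pivot j :
  [seq nth (kb0 N s) (kbasis e t S j.+1) k | k <- krows e t S pivot_sel j.+1]
  = pivots p t S j.+1.
Proof. by rewrite /pivots -{2}(mkseq_nth (kb0 N s) (kbasis _ _ _ _)) filter_map. Qed.

Lemma kcols_pivot j :
  [seq nth (kb0 N s) (kbasis e t S j) k | k <- kcols e t S pivot_sel j.+1]
  = targets p t S j.
Proof. by rewrite /targets -{2}(mkseq_nth (kb0 N s) (kbasis _ _ _ _)) filter_map. Qed.

Lemma size_krows_pivot j :
  size (krows e t S pivot_sel j.+1) = size (pivots p t S j.+1).
Proof. by rewrite -krows_pivot size_map. Qed.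

Lemma size_kcols_pivot j :
  size (kcols e t S pivot_sel j.+1) = size (targets p t S j).
Proof. by rewrite -kcols_pivot size_map. Qed.

Lemma kminor_pivot j : size (pivots p t S j.+1) = size (targets p t S j) ->
  kminor P e t S pivot_sel j.+1 = pivot_minor p t S j.
Proof.
move=> szE; rewrite /kminor /pivot_minor size_krows_pivot.
congr (\det _); apply/matrixP=> a b; rewrite !mxE kentE; congr (koszul_entry _ _).
  rewrite -[RHS](congr1 (fun r => nth _ r a) (krows_pivot j)).
  by rewrite (nth_map 0%N) ?size_krows_pivot.
rewrite -[RHS](congr1 (fun r => nth _ r b) (kcols_pivot j)).
by rewrite (nth_map 0%N) // size_kcols_pivot -szE.
Qed.

End Selection.

Lemma rank_kmx_ge t S sel j : size (krows e t S sel j) = size (kcols e t S sel j) ->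
  kminor P e t S sel j != 0 -> (size (krows e t S sel j) <= \rank (kmx P e t S j))%N.
Proof.
move=> szE; rewrite -tofrac_eq0 /kminor -det_map_mx.
have rP (a : 'I_(size (krows e t S sel j))) :
    (nth 0%N (krows e t S sel j) a < kdim e t S j)%N.
  have : nth 0%N (krows e t S sel j) a \in krows e t S sel j by rewrite mem_nth.
  by rewrite mem_filter mem_iota => /andP[].
have cP (a : 'I_(size (krows e t S sel j))) :
    (nth 0%N (kcols e t S sel j) a < kdim e t S j.-1)%N.
  have : nth 0%N (kcols e t S sel j) a \in kcols e t S sel j by rewrite mem_nth -?szE.
  by rewrite mem_filter mem_iota => /andP[].
set M := map_mx _ _.
have -> : M = rowsub (fun a => Ordinal (rP a)) (kmx P e t S j)
              *m colsub (fun a => Ordinal (cP a)) 1%:M.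
  by rewrite -mxsub_mul mulmx1; apply/matrixP=> a b; rewrite !mxE.
rewrite -unitfE -unitmxE -row_free_unit => /eqP {1}<-.
by apply: leq_trans (mxrankM_maxl _ _) _; rewrite rowsubE mxrankM_maxr.
Qed.

(** The square-zero condition bounds the sum of two consecutive ranks above by [kdim j]. The nonzero
    minors bound it below by their sizes, which add up to [kdim j]. *)
Lemma koszul_exact_minors t S sel :
    (forall j, kmx P e t S j.+1 *m kmx P e t S j = 0) ->
    krows e t S sel 0 = [::] ->
    (forall j, (1 <= j <= s.+1)%N -> size (krows e t S sel j) = size (kcols e t S sel j)
        /\ kminor P e t S sel j != 0) ->
  koszul_exact P e t S.
Proof.
move=> dd sel0 selP j js.
have rge i : (i <= s.+1)%N -> (size (krows e t S sel i) <= \rank (kmx P e t S i))%N.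
  case: i => [|i] ib; first by rewrite sel0.
  by case: (selP i.+1 ib) => *; apply: rank_kmx_ge.
have le : (kmx P e t S j.+1 <= kermx (kmx P e t S j))%MS by apply/sub_kermxP.
rewrite -(mxrank_leqif_eq le) eqn_leq (mxrank_leqif_eq le) mxrank_ker leq_subLR.
have := size_krows_cols e t S sel j; case: (selP j.+1 js) => <- _.
by have := rge j (leqW js); have := rge j.+1 js; lia.
Qed.

(** Replaces the unknown selection behind [D] by the pivots. Square nonzero minors are supplied
    above the last map; the last minor is then square by comparing ranks, and nonzero if [D] is. *)
Lemma subres_pivot p t S D :
    koszul_exact P e t S -> is_subres P e t S D ->
    (forall j, (0 < j <= s)%N ->
       size (pivots p t S j.+1) = size (targets p t S j) /\ pivot_minor p t S j != 0) ->
  [/\ size (pivots p t S 1) = size (targets p t S 0),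
      D != 0 -> pivot_minor p t S 0 != 0
    & eq_sign (D * \prod_(0 <= j < s.+1 | odd j) pivot_minor p t S j)
              (\prod_(0 <= j < s.+1 | ~~ odd j) pivot_minor p t S j)].
Proof.
move=> ex [|[//]] [_ [sel [sel0 selP selD]]] pP.
have szE i : (1 < i <= s.+1)%N ->
    size (krows e t S (pivot_sel p t S) i) = size (kcols e t S (pivot_sel p t S) i).
  case: i => [|[|i]] // ib; rewrite size_krows_pivot size_kcols_pivot.
  by case: (pP i.+1 ib).
have szE' i : (1 < i <= s.+1)%N -> size (krows e t S sel i) = size (kcols e t S sel i).
  by case/andP=> i1 ib; case: (selP i); rewrite ?ib // ltnW.
have sz1 : size (pivots p t S 1) = size (targets p t S 0).
  rewrite -size_krows_pivot -size_kcols_pivot (rank_kmx ex _ szE) //.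
  rewrite -(rank_kmx ex _ szE') // (selP 1%N isT).1.
  have := size_krows_cols e t S sel 0; have := size_krows_cols e t S (pivot_sel p t S) 0.
  by rewrite sel0 krows_pivot0 => <-.
have := cayley_indep ex (krows_pivot0 p t S) sel0 szE szE'.
(* [pivot_minor] at [j] belongs to the map from [K_(j+1)] to [K_j]; the shift exchanges even and odd
   in Cayley's formula. *)
have mE (Q : pred nat) : \prod_(1 <= j < s.+2 | Q j) kminor P e t S (pivot_sel p t S) j
    = \prod_(0 <= j < s.+1 | Q j.+1) pivot_minor p t S j.
  rewrite big_add1; apply: congr_big_nat => // j /andP[_ js].
  rewrite kminor_pivot //; case: j js => // j js; by case: (pP j.+1 js).
rewrite (mE odd) (mE (fun j => ~~ odd j)) /=.
rewrite (eq_bigl odd _ (fun j => negbK (odd j))).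
set O := \prod_(0 <= j < _ | ~~ odd j) _; set E := \prod_(0 <= j < _ | odd j) _.
have Ev'0 : \prod_(1 <= j < s.+2 | ~~ odd j) kminor P e t S sel j != 0.
  rewrite prodf_seq_neq0; apply/allP => j; rewrite mem_index_iota => jb.
  by apply/implyP => _; case: (selP j jb).
rewrite -selD mulrAC => indep.
have OE : eq_sign (D * E) O by apply/eq_sign_sym/(eq_sign_mulIf Ev'0).
split=> // D0.
have E0 : E != 0.
  rewrite prodf_seq_neq0; apply/allP => j; rewrite mem_index_iota => /andP[_ js].
  by apply/implyP => oj; case: (pP j) => //; case: j js oj.
have : O != 0 by rewrite -(eq_sign_eq0 OE) mulf_neq0.
by rewrite /O big_ltn_cond //= mulf_eq0 negb_or => /andP[].
Qed.

End KoszulEntry.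

(** * The Koszul complex of pure powers *)

Section Matching.
Variables (n : nat) (d : 'I_n -> nat).
Implicit Types (x y : {set 'I_n} * 'X_{1..n}) (u : 'X_{1..n}).

(* For P_i = x_i^{d_i} the complex splits, by multidegree u, into chain
   complexes of simplices with vertices {i | d_i <= u_i}; coning
   from the least vertex matches its basis perfectly. *)
Definition multidegree x : 'X_{1..n} :=
  [multinom (x.2 i + (i \in x.1) * d i)%N | i < n].

Definition least_vertex u (i : 'I_n) :=
  (d i <= u i)%N && [forall k : 'I_n, (k < i)%N ==> (u k < d k)%N].

Definition is_pivot x := [exists i in x.1, least_vertex (multidegree x) i].

(** The face opposite to the cone vertex, with [x_i^(d i)] moved into the monomial to keep the
    multidegree; non-pivots are left fixed. *)
Definition partner x : {set 'I_n} * 'X_{1..n} :=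
  if [pick i in x.1 | least_vertex (multidegree x) i] is Some i
  then (x.1 :\ i, (x.2 + U_(i) *+ d i)%MM) else x.

(** Multidegrees without any vertex: these monomials form a basis of the quotient by all the
    [x_i^(d i)]. *)
Definition in_box u := [forall i, (u i < d i)%N].

Lemma least_vertex_uniq u i k : least_vertex u i -> least_vertex u k -> i = k.
Proof.
move=> /andP[ui /forallP/(_ k) ik] /andP[uk /forallP/(_ i) ki]; apply: val_inj => /=.
by case: (ltngtP i k) ik ki => //= _; rewrite ?ltnNge ?ui ?uk.
Qed.

Lemma in_boxPn u : ~~ in_box u -> exists i, least_vertex u i.
Proof.
move/forallPn => [i0 h0]; rewrite -leqNgt in h0.
case: (arg_minnP (fun i : 'I_n => val i) (h0 : (fun i => (d i <= u i)%N) i0)) => i di imin.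
exists i; rewrite /least_vertex di; apply/forallP => k; apply/implyP => ki.
by rewrite ltnNge; apply: contraL ki => /imin; rewrite -leqNgt.
Qed.

Lemma pivotP x :
  reflect (exists2 i, i \in x.1 & least_vertex (multidegree x) i) (is_pivot x).
Proof.
by apply: (iffP exists_inP) => -[i]; exists i.
Qed.

Lemma partnerE x i : i \in x.1 -> least_vertex (multidegree x) i ->
  partner x = (x.1 :\ i, (x.2 + U_(i) *+ d i)%MM).
Proof.
move=> xi li; rewrite /partner; case: pickP => [k /andP[_ lk]|/(_ i)].
  by rewrite (least_vertex_uniq lk li).
by rewrite xi li.
Qed.

Lemma mnmUE (i k : 'I_n) c : (U_(i) *+ c)%MM k = ((i == k) * c)%N.
Proof. by rewrite mulmnE mnm1E. Qed.

Lemma multidegree_move x i : i \in x.1 ->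
  multidegree (x.1 :\ i, (x.2 + U_(i) *+ d i)%MM) = multidegree x.
Proof.
move=> xi; apply/mnmP=> k; rewrite !mnmE /= mnmUE !inE.
by case: eqVneq => [<-|ki]; rewrite ?eqxx ?xi ?ki ?(eq_sym k) ?(negbTE ki) /=; lia.
Qed.

Lemma partner_inj : {in is_pivot &, injective partner}.
Proof.
move=> x y /pivotP[i xi li] /pivotP[k yk lk].
rewrite (partnerE xi li) (partnerE yk lk) => E.
have ti := multidegree_move xi; rewrite E multidegree_move // in ti.
rewrite -ti in li; have ik := least_vertex_uniq li lk; subst k.
have EJ : x.1 = y.1 by rewrite -(setD1K xi) -(setD1K yk); case: E => ->.
have Em : x.2 = y.2.
  apply/mnmP=> k.
  have /= := congr1 (fun z : {set 'I_n} * 'X_{1..n} => fun_of_multinom z.2 k) E.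
  by rewrite !mnmDE => /addIn.
by rewrite (surjective_pairing x) EJ Em -surjective_pairing.
Qed.

(** Deleting a vertex other than the cone vertex leaves a simplex that still contains it, which no
    partner of a pivot of that multidegree does. Hence the specialized differential is diagonal
    along the matching. *)
Lemma partner_fiber x y i : is_pivot x -> is_pivot y -> i \in x.1 ->
  partner y = (x.1 :\ i, (x.2 + U_(i) *+ d i)%MM) -> x = y.
Proof.
move=> px py xi yE; apply: (partner_inj px py); case/pivotP: px => k xk lk.
case/pivotP: py => k' yk' lk'.
have tE : multidegree y = multidegree x.
  by rewrite -(multidegree_move xi) -yE (partnerE yk' lk') multidegree_move.
have kk' : k' = k by apply: (least_vertex_uniq lk'); rewrite tE.
rewrite yE (partnerE xk lk); suff -> : i = k by [].
apply/eqP; apply: contraT => ik; have : k \in (partner y).1 by rewrite yE !inE eq_sym ik.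
by rewrite (partnerE yk' lk') kk' !inE eqxx.
Qed.

Lemma esum_setD1 (J : {set 'I_n}) i : i \in J -> esum d J = (d i + esum d (J :\ i))%N.
Proof. exact: big_setD1. Qed.

(** The inverse adjoins the least vertex [i] and divides the monomial by [x_i^(d i)]; this is
    possible for a non-pivot whose multidegree lies outside the box. *)
Lemma partner_perm t j :
  perm_eq [seq partner x | x <- pivots d is_pivot t [::] j.+1]
          [seq y <- kbasis d t [::] j | ~~ is_pivot y && ~~ in_box (multidegree y)].
Proof.
apply: uniq_perm.
- rewrite map_inj_in_uniq ?filter_uniq ?uniq_kbasis // => x y.
  by rewrite !mem_filter => /andP[px _] /andP[py _]; apply: partner_inj.
- by rewrite filter_uniq ?uniq_kbasis.
move=> y; rewrite mem_filter mem_kbasis; apply/mapP/idP => [[x]|].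
  rewrite mem_filter mem_kbasis => /andP[/pivotP[i xi li] /and3P[/eqP xj /eqP xt _]].
  rewrite (partnerE xi li) => ->; rewrite multidegree_move //= implybT andbT.
  apply/and3P; split; [apply/andP; split| |].
  - apply/pivotP => -[k]; rewrite multidegree_move // inE => /andP[/= ki _ lk].
    by rewrite (least_vertex_uniq lk li) inE eqxx in ki.
  - by apply/forallPn; exists i; rewrite -leqNgt; case/andP: li.
  - by move: xj; rewrite (cardsD1 i) xi => -[<-].
  - by rewrite -xt (esum_setD1 xi) mdegD mdegMn mdeg1 mul1n; apply/eqP; lia.
move=> /andP[/andP[yp yb] /and3P[/eqP yj /eqP yt _]].
have [i li] := in_boxPn yb.
have yi : i \notin y.1 by apply: contra yp => yi; apply/pivotP; exists i.
have di : (U_(i) *+ d i <= y.2)%MM.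
  apply/mnm_lepP => k; rewrite mnmUE; case: eqVneq => [<-|//].
  by case/andP: li; rewrite mnmE (negbTE yi) addn0 mul1n.
pose x := (i |: y.1, (y.2 - U_(i) *+ d i)%MM).
have xi : i \in x.1 by rewrite !inE eqxx.
have yE : y = (x.1 :\ i, (x.2 + U_(i) *+ d i)%MM).
  by rewrite /= setU1K // submK //; case: (y).
have lx : least_vertex (multidegree x) i by rewrite -(multidegree_move xi) -yE.
exists x; last by rewrite (partnerE xi lx) -yE.
rewrite mem_filter mem_kbasis; apply/and4P; split => //.
- by apply/pivotP; exists i.
- by rewrite /= cardsU1 yi yj.
have e2 : mdeg y.2 = (mdeg x.2 + d i)%N.
  by rewrite {1}yE mdegD mdegMn mdeg1 mul1n.
by rewrite (esum_setD1 xi) setU1K // -yt e2 -addnA addnC -addnA.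
Qed.

Lemma multidegree_notin_box x : x.1 != set0 -> ~~ in_box (multidegree x).
Proof.
case/set0Pn => i xi; apply/forallPn; exists i.
by rewrite mnmE xi mul1n -leqNgt leq_addl.
Qed.

Lemma partner_targets t S j : (0 < j)%N ->
  perm_eq [seq partner x | x <- pivots d is_pivot t S j.+1]
          (targets d is_pivot t S j).
Proof.
case: j => // j _; rewrite (perm_trans (partner_perm t j.+1)) //.
rewrite /targets /= (eq_in_filter (a2 := fun y => ~~ is_pivot y)) // => y.
rewrite -/(kbasis d t S j.+1) mem_kbasis => /andP[/eqP yj _].
by rewrite multidegree_notin_box ?andbT // -card_gt0 yj.
Qed.

Lemma size_pivots t S j : (0 < j)%N ->
  size (pivots d is_pivot t S j.+1) = size (targets d is_pivot t S j).
Proof. by move=> j0; rewrite -(perm_size (partner_targets t S j0)) size_map. Qed.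

(** Pivots of degree 1 match the monomials outside the box, while the targets in degree 0 are the
    monomials outside [S]; the complements are compared. *)
Lemma size_pivots1 t S : uniq S -> {in S, forall m, mdeg m = t} ->
  (size (pivots d is_pivot t S 1) == size (targets d is_pivot t S 0))
  = (size S == count in_box (mons n t)).
Proof.
move=> Su St.
have -> : size (pivots d is_pivot t S 1) = (size (mons n t) - count in_box (mons n t))%N.
  (* Above degree 0 the Koszul basis ignores [S], so [S] may be emptied to apply [partner_perm]. *)
  rewrite -[pivots _ _ _ _ _]/(pivots d is_pivot t [::] 1) -(size_map partner).
  rewrite (perm_size (partner_perm t 0)) size_filter /= count_map filter_predT.
  rewrite -(count_predC in_box (mons n t)) addKn; apply: eq_count => m /=.
  have -> : multidegree (set0, m) = m by apply/mnmP=> i; rewrite mnmE inE addn0.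
  suff -> : is_pivot (set0, m) = false by [].
  by apply/pivotP => -[i]; rewrite inE.
have -> : size (targets d is_pivot t S 0) = (size (mons n t) - size S)%N.
  rewrite /targets /= filter_predT size_map size_filter.
  rewrite -(count_predC (mem S) (mons n t)).
  suff -> : count (mem S) (mons n t) = size S by rewrite addKn; apply: eq_count.
  rewrite -size_filter; apply/perm_size/uniq_perm => //.
    by rewrite filter_uniq ?uniq_mons.
  move=> m; rewrite mem_filter mem_mons andbC.
  by apply: andb_idl => /St ->.
have := count_size in_box (mons n t).
have : (size S <= size (mons n t))%N.
  by apply: uniq_leq_size => // m /St mt; rewrite mem_mons mt.
by lia.
Qed.

End Matching.

(** * Polynomials in the top coefficients *)

Section FreeVariables.
Variables (K : fieldType) (N : nat) (top : pred 'I_N).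
Implicit Types p q : {mpoly K[N]}.

(* Constant in T exactly when only variables in [top] occur; as degrees in T add
   up, that property passes to factors. *)
Definition grade_lower : {mpoly K[N]} -> {poly {mpoly K[N]}} :=
  mmap (polyC \o mpolyC N (R := K)) (fun k => ('X_k)%:P * 'X^(~~ top k)).

HB.instance Definition _ := GRing.RMorphism.on grade_lower.

Lemma grade_lowerX k : grade_lower 'X_k = ('X_k)%:P * 'X^(~~ top k).
Proof. by rewrite /grade_lower mmapX mmap1U. Qed.

Definition lower_weight (m : 'X_{1..N}) := (\sum_(k < N) ~~ top k * m k)%N.

Lemma grade_lowerE p : grade_lower p =
  \sum_(m <- msupp p) (p@_m *: 'X_[m])%:P * 'X^(lower_weight m).
Proof.
rewrite [LHS]/mmap; apply: eq_bigr => m _.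
have -> : mmap1 (fun k => ('X_k)%:P * 'X^(~~ top k)) m
    = ('X_[m])%:P * 'X^(lower_weight m) :> {poly {mpoly K[N]}}.
  rewrite mpolyXE_id rmorph_prod /lower_weight -prodrXr -big_split /=.
  by apply: eq_bigr => k _; rewrite exprMn -exprM rmorphXn.
by rewrite mulrA -polyCM mul_mpolyC.
Qed.

Lemma grade_lower_at1 p : (grade_lower p).[1] = p.
Proof.
rewrite grade_lowerE horner_sum [RHS]mpolyE; apply: eq_bigr => m _.
by rewrite hornerM hornerC hornerXn expr1n mulr1.
Qed.

Lemma grade_lowerP p : grade_lower p = p%:P <->
  (forall m, m \in msupp p -> forall k, ~~ top k -> m k = 0%N).
Proof.
split=> [pE m mp k tk|pP]; last first.
  rewrite grade_lowerE {3}[p]mpolyE rmorph_sum /=; apply: eq_big_seq => m mp.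
  rewrite [lower_weight m]big1 ?mulr1 // => k _.
  by case: (boolP (top k)) => // /(pP m mp) ->.
apply/eqP; apply: contraTT mp; rewrite -lt0n mcoeff_msupp negbK => mk.
have wm : lower_weight m != 0%N.
  by rewrite /lower_weight (bigD1 k) //= tk mul1n -lt0n addn_gt0 mk.
have := congr1 (fun q : {poly {mpoly K[N]}} => q`_(lower_weight m)) pE.
rewrite coefC (negbTE wm) grade_lowerE coef_sum => /(congr1 (mcoeff m)).
rewrite raddf_sum mcoeff0 /= => E; apply/eqP.
have [mp|/memN_msupp_eq0 //] := boolP (m \in msupp p).
rewrite (bigD1_seq m) ?msupp_uniq //= coefCM coefXn eqxx mulr1 mcoeffZ mcoeffX in E.
rewrite eqxx mulr1 big1 ?addr0 // in E => m' /negbTE m'm.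
rewrite coefCM coefXn; case: eqP; rewrite ?mulr0 ?mcoeff0 // mulr1.
by rewrite mcoeffZ mcoeffX m'm mulr0.
Qed.

Lemma grade_lower_factor p q : p * q != 0 ->
  grade_lower (p * q) = (p * q)%:P -> grade_lower p = p%:P.
Proof.
rewrite mulf_eq0 negb_or => /andP[p0 q0] pqE.
have nz r : r != 0 -> grade_lower r != 0.
  by apply: contraNneq => r0; rewrite -[r]grade_lower_at1 r0 horner0.
have : (size (grade_lower p * grade_lower q)%R <= 1)%N.
  by have := size_polyC_leq1 (p * q); rewrite -pqE rmorphM.
have [{}p0 {}q0] : grade_lower p != 0 /\ grade_lower q != 0 by split; apply: nz.
move: (grade_lower_at1 p) p0 q0; move: (grade_lower p) (grade_lower q) => P Q.
move=> P1 P0 Q0; rewrite size_mul // => sz.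
have : (size P <= 1)%N.
  have Q1 : (0 < size Q)%N by rewrite size_poly_gt0.
  by move: sz Q1; move: (size P) (size Q) => a b; lia.
move/size1_polyC => E; rewrite -P1 E hornerC //.
Qed.

(** Evaluation at T = 0 kills the variables outside [top] and, as a ring morphism, commutes with
    determinants. *)
Lemma grade_lower_sdet0 (T : eqType) (x0 : T) m (E : T -> T -> {mpoly K[N]}) r c :
  (grade_lower (sdet x0 m E r c)).[0]
  = sdet x0 m (fun x y => (grade_lower (E x y)).[0]) r c.
Proof.
rewrite (sdet_rmorph grade_lower).
exact: (sdet_rmorph (horner_eval (0 : {mpoly K[N]}))).
Qed.

End FreeVariables.

(** * Koszul entries of the generic systems *)

Section GenericSystem.
Variables (K : fieldType) (n : nat) (d : 'I_n -> nat).
Local Notation CR := (CR K d).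
Local Notation basis_elt := ({set 'I_n} * 'X_{1..n})%type.
Implicit Types (x y : basis_elt).
Local Notation kbT := (kb0 n n).
Local Notation kbH := (kb0 n.+1 n).

Lemma mcoeff_mulX_sum N (I : finType) (Q : pred I) (c : I -> CR)
    (a : I -> 'X_{1..N}) (m m' : 'X_{1..N}) :
  ('X_[m] * \sum_(k | Q k) c k *: 'X_[a k])@_m'
  = \sum_(k | Q k) c k * ((m + a k)%MM == m')%:R.
Proof.
rewrite mulr_sumr raddf_sum; apply: eq_bigr => k _ /=.
by rewrite -scalerAr -mpolyXD mcoeffZ mcoeffX.
Qed.

Lemma mem_cidx i a : ((val i, a) \in cidx d) = (mdeg a <= d i)%N.
Proof.
apply/flatten_mapP/idP => [[k _ /mapP[b /mapP[c _ bE] [/val_inj -> ->]]]|ai].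
  by rewrite bE -ltnS bmdeg.
exists i; rewrite ?mem_enum //; apply/mapP; exists a => //.
rewrite -ltnS in ai; by apply/mapP; exists (BMultinom ai); rewrite ?mem_enum.
Qed.

Lemma mdeg_cvar (i : 'I_n) (k : 'I_(ncoef d)) :
  (cvar k).1 == val i -> (mdeg (cvar k).2 <= d i)%N.
Proof.
move/eqP => ki; rewrite -mem_cidx -ki -surjective_pairing.
by rewrite /cvar mem_nth.
Qed.

(** Evaluation at this 0-1 vector specializes [f_i] to [x_i^(d i)]. *)
Definition pure_power (k : 'I_(ncoef d)) : bool :=
  [exists i : 'I_n, k == index (val i, (U_(i) *+ d i)%MM) (cidx d) :> nat].

Lemma meval_ftop (i : 'I_n) (m m' : 'X_{1..n}) :
  meval (fun k => (pure_power k)%:R) (('X_[m] * ftop K d i)@_m')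
  = ((m + U_(i) *+ d i)%MM == m')%:R.
Proof.
rewrite mcoeff_mulX_sum rmorph_sum /=.
have iP : (val i, (U_(i) *+ d i)%MM) \in cidx d.
  by rewrite mem_cidx mdegMn mdeg1 mul1n.
have k0P := iP; rewrite -index_mem in k0P.
have k0E : cvar (Ordinal k0P) = (val i, (U_(i) *+ d i)%MM) by rewrite /cvar nth_index.
rewrite (bigD1 (Ordinal k0P)) ?k0E /= ?eqxx ?mdegMn ?mdeg1 ?mul1n ?eqxx //=.
rewrite mevalM mevalXU rmorph_nat big1 ?addr0.
  by rewrite (_ : pure_power _ = true) ?mul1r //; apply/existsP; exists i.
move=> k /andP[/andP[/eqP ki _] kk0]; rewrite mevalM mevalXU.
rewrite (_ : pure_power k = false) ?mul0r //; apply/existsP => -[i' /eqP ki'].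
have i'P : (val i', (U_(i') *+ d i')%MM) \in cidx d.
  by rewrite mem_cidx mdegMn mdeg1 mul1n.
have kE : cvar k = (val i', (U_(i') *+ d i')%MM) by rewrite /cvar ki' nth_index.
have /val_inj ii : val i' = val i by move: ki; rewrite kE.
by case/eqP: kk0; apply: val_inj; rewrite /= ki' ii.
Qed.

(** It suffices to specialize to pure powers. With the columns listed as the partners of the rows,
    [partner_fiber] makes the specialized matrix diagonal, with signs on the diagonal. *)
Lemma top_pivot_minor_neq0 t S j : (0 < j)%N ->
  pivot_minor (ftop K d) d (is_pivot d) t S j != 0.
Proof.
move=> j0; pose f : {rmorphism CR -> K} := meval (fun k : 'I_(ncoef d) => (pure_power k)%:R).
suff : f (pivot_minor (ftop K d) d (is_pivot d) t S j) != 0.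
  by apply: contraNneq => ->; rewrite rmorph0.
rewrite /pivot_minor.
set r := pivots d _ t S j.+1.
rewrite (sdet_rmorph f); set E := (fun x y => _).
have rr' : perm_eq (targets d (is_pivot d) t S j) [seq partner d x | x <- r].
  by rewrite perm_sym partner_targets.
have szt : size (targets d (is_pivot d) t S j) = size r by rewrite size_pivots.
rewrite (eq_sign_eq0 (sdet_perm _ E erefl szt (perm_refl r) rr')).
have EF x y : E x y = \sum_(i in x.1 | y.1 == x.1 :\ i)
    (-1) ^+ index i (enum x.1) * ((x.2 + U_(i) *+ d i)%MM == y.2)%:R.
  rewrite /E rmorph_sum; apply: eq_bigr => i _.
  by rewrite rmorphM rmorph_sign; congr (_ * _); apply: meval_ftop.
have EE : {in r &, forall x y, E x (partner d y) = 0 \/ x = y}.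
  move=> x y; rewrite !mem_filter => /andP[px _] /andP[py _].
  have [xy|/eqP xy] := x =P y; [by right | left].
  rewrite EF big1 // => i /andP[xi /eqP e1]; case: eqP; rewrite ?mulr0 // => e2.
  case/eqP: xy; apply: (partner_fiber px py xi).
  by rewrite (surjective_pairing (partner d y)) e1 e2.
have ED : {in r, forall x, E x (partner d x) != 0}.
  move=> x; rewrite mem_filter => /andP[/pivotP[i xi li] _].
  rewrite EF (partnerE xi li) (bigD1 i) /= ?xi ?eqxx // mulr1.
  rewrite big1 ?addr0 ?signr_eq0 // => k /andP[/andP[xk /eqP ik] ki].
  by have := setD11 k x.1; rewrite -ik !inE ki xk.
have ur : uniq r by rewrite filter_uniq ?uniq_kbasis.
rewrite /sdet det_trig.
  apply/prodf_neq0 => a _; rewrite mxE (nth_map kbT) ?ltn_ord //.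
  by apply: ED; rewrite mem_nth.
apply/is_trig_mxP => a b ab; rewrite mxE (nth_map kbT) ?ltn_ord //.
case: (EE (nth kbT r a) (nth kbT r b)) => //; rewrite ?mem_nth //.
by move/eqP; rewrite nth_uniq // => /eqP ab'; rewrite ab' ltnn in ab.
Qed.

Definition lift_elt (delta : nat) x : {set 'I_n} * 'X_{1..n.+1} :=
  (x.1, homog_mon (delta - esum d x.1) x.2).

(** Filtration degree, with [e_i] in degree [d i]: in the differential the top coefficients preserve
    it and all others lower it. *)
Definition weight x := (esum d x.1 + mdeg x.2)%N.

Lemma homog_monE e (m : 'X_{1..n}) i : homog_mon e m (lift ord0 i) = m i.
Proof. by rewrite mnmE liftK. Qed.

Lemma homog_mon0 e (m : 'X_{1..n}) : homog_mon e m ord0 = (e - mdeg m)%N.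
Proof. by rewrite mnmE unlift_none. Qed.

Lemma homog_mon_inj e : injective (homog_mon (n := n) e).
Proof.
by move=> m m' /mnmP E; apply/mnmP=> i; have := E (lift ord0 i); rewrite !homog_monE.
Qed.

Lemma homog_monD e e' (m m' : 'X_{1..n}) : (mdeg m <= e)%N -> (mdeg m' <= e')%N ->
  (homog_mon e m + homog_mon e' m')%MM = homog_mon (e + e') (m + m')%MM.
Proof.
move=> me me'; apply/mnmP=> i; rewrite mnmDE.
case: (unliftP ord0 i) => [k|] ->; first by rewrite !homog_monE mnmDE.
by rewrite !homog_mon0 mdegD; lia.
Qed.

(** Koszul entry of the inhomogeneous [f_i]: it serves for the homogenized system, by
    dehomogenizing, and within one weight for the top parts. *)
Definition affine_entry x y : CR :=
  \sum_(i in x.1 | y.1 == x.1 :\ i) (-1) ^+ index i (enum x.1) *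
    \sum_(k | (cvar k).1 == val i) 'X_k * ((x.2 + (cvar k).2)%MM == y.2)%:R.

Lemma koszul_entry_hom delta x y : (weight x <= delta)%N ->
  koszul_entry (fhom K d) (lift_elt delta x) (lift_elt delta y) = affine_entry x y.
Proof.
move=> xd; apply: eq_bigr => i /andP[/= xi /eqP /= yE]; congr (_ * _).
rewrite mcoeff_mulX_sum; apply: eq_bigr => k ki; congr (_ * _%:R).
have := xd; rewrite /weight => xd'; have es := esum_setD1 d xi.
rewrite /= homog_monD ?(mdeg_cvar ki) //; last by lia.
have -> : (delta - esum d x.1 + d i = delta - esum d y.1)%N by rewrite yE; lia.
by rewrite (inj_eq (@homog_mon_inj _)).
Qed.

Lemma affine_entry_top x y : weight x = weight y ->
  affine_entry x y = koszul_entry (ftop K d) x y.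
Proof.
move=> xy; apply: eq_bigr => i /andP[xi /eqP yE]; congr (_ * _).
rewrite mcoeff_mulX_sum [LHS]big_mkcond [RHS]big_mkcond; apply: eq_bigr => k _.
have [ki|] := boolP ((cvar k).1 == val i) => //=.
case: ifP => // kd; case: eqP; rewrite ?mulr0 // => E; case/eqP: kd.
have := xy; rewrite /weight (esum_setD1 d xi) yE -E mdegD; lia.
Qed.

Lemma affine_entry_lt x y : (weight x < weight y)%N -> affine_entry x y = 0.
Proof.
move=> xy; apply: big1 => i /andP[xi /eqP yE]; rewrite big1 ?mulr0 // => k ki.
case: eqP; rewrite ?mulr0 // => E; move: xy (mdeg_cvar ki).
rewrite /weight (esum_setD1 d xi) yE -E mdegD; lia.
Qed.

Local Notation gl := (grade_lower (K := K) (@top_coef n d)).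

(** Between different weights only lower coefficients occur, and these vanish at T = 0. *)
Lemma grade_lower_entry0 x y : weight x != weight y -> (gl (affine_entry x y)).[0] = 0.
Proof.
move=> xy; rewrite rmorph_sum horner_sum big1 // => i /andP[xi /eqP yE].
rewrite rmorphM hornerM; apply/eqP; rewrite mulf_eq0; apply/orP; right; apply/eqP.
rewrite rmorph_sum horner_sum big1 // => k ki.
case: eqP; last by rewrite mulr0 rmorph0 horner0.
rewrite mulr1 => E.
suff tk : top_coef k = false.
  have : (gl 'X_k).[0] = 0 by rewrite grade_lowerX tk hornerM hornerX mulr0.
  exact.
apply/existsP => -[i' /andP[ki' /eqP kd]]; case/eqP: xy.
have ii : i' = i by apply: val_inj; rewrite /= -(eqP ki) -(eqP ki').
by rewrite /weight (esum_setD1 d xi) yE -E mdegD kd ii; lia.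
Qed.

Lemma grade_lower_top x y :
  gl (koszul_entry (ftop K d) x y) = (koszul_entry (ftop K d) x y)%:P.
Proof.
rewrite !rmorph_sum; apply: eq_bigr => i /andP[xi _]; rewrite !rmorphM /=.
rewrite !rmorph_sign; congr (_ * _); rewrite mcoeff_mulX_sum !rmorph_sum.
apply: eq_bigr => k /andP[ki kd]; rewrite !rmorphM !rmorph_nat; congr (_ * _).
have tk : top_coef k by apply/existsP; exists i; rewrite ki.
by have := grade_lowerX K (@top_coef n d) k; rewrite tk mulr1.
Qed.

End GenericSystem.

(** * Hilbert numbers *)

Section HilbertNumbers.
Variables (n : nat) (d : 'I_n -> nat).
Hypothesis d_gt0 : forall i, (0 < d i)%N.

Local Notation hilb := (\prod_(j < n) \sum_(k < d j) ('X^k : {poly int})).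

Lemma sum_Xn_poly e : \sum_(k < e) ('X^k : {poly int}) = \poly_(k < e) 1.
Proof. by rewrite poly_def; apply: eq_bigr => k _; rewrite scale1r. Qed.

Lemma monic_sum_Xn j : \sum_(k < d j) ('X^k : {poly int}) \is monic.
Proof. by rewrite sum_Xn_poly monicE lead_coef_poly ?d_gt0 ?oner_neq0. Qed.

Lemma rhoE : (rho d + n = \sum_(i < n) d i)%N.
Proof.
rewrite subnK // -[n in (n <= _)%N]card_ord -sum1_card.
by apply: leq_sum => i _; apply: d_gt0.
Qed.

Lemma size_hilb : size hilb = (rho d).+1.
Proof.
rewrite size_prod => [|j _]; last by rewrite monic_neq0 ?monic_sum_Xn.
rewrite card_ord (eq_bigr d) => [|j _]; last first.
  by rewrite sum_Xn_poly size_poly_eq ?oner_neq0.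
by rewrite -rhoE -addSn addnK.
Qed.

Lemma hnum_rho : hnum d (rho d) = 1.
Proof.
have /monicP <- : hilb \is monic by apply: monic_prod => j _; apply: monic_sum_Xn.
by rewrite lead_coefE size_hilb.
Qed.

(** Expanding the product amounts to choosing exponents [k_j < d j] of sum [t], that is, a monomial
    of degree [t] in the box. *)
Lemma hnum_box t : hnum d t = (count (in_box d) (mons n t))%:Z.
Proof.
pose m := (\sum_(i < n) d i)%N.
have dm i : (d i <= m)%N by rewrite /m (bigD1 i) //= leq_addr.
have -> : hnum d t
    = (\sum_(f in family (fun j : 'I_n => [pred k : 'I_m | (k < d j)%N]))
        \prod_(j < n) ('X^(f j : 'I_m) : {poly int}))`_t.
  rewrite -(bigA_distr_big_dep (fun j : 'I_n => [pred k : 'I_m | (k < d j)%N])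
    (fun _ k => 'X^(k : 'I_m) : {poly int})).
  rewrite /hnum; apply: (congr1 (fun p : {poly int} => p`_t)); apply: eq_bigr => j _.
  exact: (big_ord_widen m (fun k => 'X^k : {poly int}) (dm j)).
rewrite coef_sum; pose Q := [pred f : {ffun 'I_n -> 'I_m} |
  (f \in family (fun j : 'I_n => [pred k : 'I_m | (k < d j)%N]))
  && (t == \sum_(j < n) f j)%N].
have -> : count (in_box d) (mons n t) = #|Q|.
  pose g (f : {ffun 'I_n -> 'I_m}) : 'X_{1..n} := [multinom (f i : nat) | i < n].
  rewrite cardE -(size_map g) -size_filter; apply/perm_size; rewrite perm_sym.
  apply: uniq_perm; rewrite ?filter_uniq ?uniq_mons //.
    rewrite map_inj_uniq ?enum_uniq // => f f' /mnmP ff'; apply/ffunP => i.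
    by apply: val_inj; have := ff' i; rewrite !mnmE.
  move=> u; rewrite mem_filter mem_mons; apply/mapP/andP => [[f]|[/forallP ub /eqP ut]].
    rewrite mem_enum => /andP[/familyP fb /eqP ft] ->; split.
      by apply/forallP => i; rewrite mnmE; have := fb i; rewrite inE.
    by rewrite mdegE ft; apply/eqP/eq_bigr => i _; rewrite mnmE.
  have um i : (u i < m)%N by apply: leq_trans (ub i) (dm i).
  exists [ffun i => Ordinal (um i)].
    rewrite mem_enum; apply/andP; split.
      by apply/familyP => i; rewrite ffunE inE /=.
    by rewrite -ut mdegE; apply/eqP/eq_bigr => i _; rewrite ffunE.
  by apply/mnmP => i; rewrite mnmE ffunE.
rewrite -sum1_card -[RHS]natz natr_sum [RHS]big_mkcondr; apply: eq_bigr => f _.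
by rewrite -(big_morph _ (exprD 'X) (expr0 'X)) coefXn; case: eqP.
Qed.

(** Both sides are the value of the product at T = 1, computed from its coefficients and from its
    factors. *)
Lemma sum_box N : (rho d < N)%N ->
  (\sum_(t < N) count (in_box d) (mons n t) = \prod_(i < n) d i)%N.
Proof.
move=> rN; apply/eqP; rewrite -(eqr_nat int) natr_sum natr_prod.
have <- : hilb.[1] = \prod_(i < n) (d i)%:R.
  rewrite horner_prod; apply: eq_bigr => i _; rewrite horner_sum.
  by rewrite (eq_bigr (fun=> 1)) ?sumr_const ?card_ord // => k _; rewrite hornerXn expr1n.
rewrite (horner_coef_wide _ (n := N)) ?size_hilb //; apply/eqP/eq_bigr => t _.
by rewrite expr1n mulr1 natz -hnum_box.
Qed.

End HilbertNumbers.

Lemma sum_count_lt (T : Type) (f : T -> nat) (s : seq T) N :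
  (\sum_(t < N) count (fun x => f x == t) s = count (fun x => f x < N) s)%N.
Proof.
elim: s => [|x s IH] /=; first by rewrite big1.
rewrite big_split /= IH; congr (_ + _)%N.
have [xN|xN] := ltnP (f x) N.
  rewrite (bigD1 (Ordinal xN)) //= eqxx big1 // => t /negbTE tx.
  by rewrite eq_sym -[f x]/(val (Ordinal xN)) val_eqE tx.
by rewrite big1 // => t _; case: eqP => // E; have := ltn_ord t; rewrite -E ltnNge xN.
Qed.

(** * Graded pieces of the homogenized complex *)

Lemma uniq_flatten_key (T I : eqType) (F : I -> seq T) (w : T -> I) (s : seq I) :
    uniq s -> (forall t, uniq (F t)) -> (forall t x, x \in F t -> w x = t) ->
  uniq (flatten [seq F t | t <- s]).
Proof.
move=> us uF wF; elim: s us => //= t s IH /andP[ts /IH us].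
rewrite cat_uniq uF us andbT /=; apply/hasPn => x /flatten_mapP[t' t's xt'].
by apply: contra ts => xt; rewrite -(wF _ _ xt) (wF _ _ xt').
Qed.

Lemma count_flatten_key (T I : eqType) (F : I -> seq T) (w : T -> I) (s : seq I) i :
    uniq s -> i \in s -> (forall t x, x \in F t -> w x = t) ->
  count (fun x => w x == i) (flatten [seq F t | t <- s]) = size (F i).
Proof.
move=> us si wF; rewrite count_flatten -map_comp sumnE big_map.
rewrite (bigD1_seq i) //= big1 => [|t /negbTE ti]; last first.
  rewrite -(count_pred0 (F t)); apply: eq_in_count => x /wF ->.
  by rewrite ti.
rewrite addn0 -(count_predT (F i)); apply: eq_in_count => x /wF ->.
by rewrite eqxx.
Qed.

#[local] Arguments kbasis : simpl never.

Section KoszulSquare.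
Variables (A : idomainType) (N s : nat).
Variables (P : 'I_s -> {mpoly A[N]}) (e : 'I_s -> nat) (t : nat).
Variable (S : seq 'X_{1..N}).

Lemma kmx_sqr j : kmx P e t S j.+1 *m kmx P e t S j = 0 <->
  {in kbasis e t S j.+1 & kbasis e t S j.-1, forall x z,
    \sum_(y <- kbasis e t S j) koszul_entry P x y * koszul_entry P y z = 0}.
Proof.
have sumE a c :
    \sum_(b < kdim e t S j) tofrac (kent P e t S j.+1 a b) * tofrac (kent P e t S j b c)
    = tofrac (\sum_(y <- kbasis e t S j)
         koszul_entry P (nth (kb0 N s) (kbasis e t S j.+1) a) y
       * koszul_entry P y (nth (kb0 N s) (kbasis e t S j.-1) c)).
  rewrite (big_nth (kb0 N s)) big_mkord raddf_sum /=; apply: eq_bigr => b _.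
  by rewrite rmorphM !kentE.
split=> [sq0 x z xb zb|sq0].
  have xi : (index x (kbasis e t S j.+1) < kdim e t S j.+1)%N by rewrite index_mem.
  have zi : (index z (kbasis e t S j.-1) < kdim e t S j.-1)%N by rewrite index_mem.
  have /matrixP/(_ (Ordinal xi) (Ordinal zi)) := sq0; rewrite !mxE.
  under eq_bigr do rewrite !mxE.
  by rewrite sumE !nth_index // => /eqP; rewrite tofrac_eq0 => /eqP.
apply/matrixP=> a c; rewrite !mxE; under eq_bigr do rewrite !mxE.
by rewrite sumE sq0 ?tofrac0 ?mem_nth.
Qed.

End KoszulSquare.

Section Decomposition.
Variables (K : fieldType) (n : nat) (d : 'I_n -> nat) (M : seq 'X_{1..n}).
Hypothesis uniqM : uniq M.
Local Notation delta := (deltaM M).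
Local Notation basis_elt := ({set 'I_n} * 'X_{1..n})%type.
Local Notation kbT := (kb0 n n).
Local Notation kbH := (kb0 n.+1 n).
Local Notation MH := [seq homog_mon delta m | m <- M].
Local Notation MT t := [seq m <- M | mdeg m == t].
Local Notation fH := (fhom K d).
Local Notation fT := (ftop K d).
Local Notation emb := (lift_elt d delta).
Local Notation wt := (weight d).
Local Notation flat F := (flatten [seq F t | t <- iota 0 delta.+1]).

Definition unlift_elt (z : {set 'I_n} * 'X_{1..n.+1}) : basis_elt :=
  (z.1, [multinom z.2 (lift ord0 i) | i < n]).

Lemma lift_eltK x : unlift_elt (emb x) = x.
Proof.
rewrite (surjective_pairing x); congr (_, _).
by apply/mnmP=> i; rewrite mnmE homog_monE.
Qed.

Lemma mdeg_homog e (m : 'X_{1..n}) : (mdeg m <= e)%N -> mdeg (homog_mon e m) = e.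
Proof.
move=> me; rewrite mdegE big_ord_recl homog_mon0 addnC.
by rewrite (eq_bigr m) => [|i _]; rewrite ?homog_monE // -mdegE subnKC.
Qed.

Lemma mem_flat_kbasis j x : (x \in flat (fun t => kbasis d t (MT t) j)) =
  [&& #|x.1| == j, wt x <= delta & (j == 0) ==> (x.2 \notin M)]%N.
Proof.
apply/flatten_mapP/and3P => [[t]|[xj xd xM]].
  rewrite mem_iota add0n ltnS mem_kbasis => td /and3P[xj /eqP xt xM].
  split=> //; first by rewrite /weight xt.
  case: j xj xM => //= x0; rewrite mem_filter negb_and => /orP[|//].
  move: x0 xt; rewrite cards_eq0 => /eqP ->; rewrite /esum big_set0 add0n => ->.
  by rewrite eqxx.
exists (wt x); first by rewrite mem_iota add0n ltnS.
rewrite mem_kbasis xj eqxx /=; apply/implyP => j0; rewrite mem_filter negb_and.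
by move: xM; rewrite j0 /= => ->; rewrite orbT.
Qed.

Lemma uniq_flat_kbasis j : uniq (flat (fun t => kbasis d t (MT t) j)).
Proof.
apply: (uniq_flatten_key (w := wt) (iota_uniq _ _)) => [t|t x].
  exact: uniq_kbasis.
by rewrite mem_kbasis => /and3P[_ /eqP].
Qed.

(** The exponent of [x_0] is determined by the total degree [delta], so dehomogenizing is a
    bijection onto the elements of weight at most [delta], under which [MH] corresponds to [M]. *)
Lemma kbasis_hom j : perm_eq (kbasis d delta MH j)
  [seq emb x | x <- flat (fun t => kbasis d t (MT t) j)].
Proof.
apply: uniq_perm; first exact: uniq_kbasis.
  by rewrite map_inj_uniq ?uniq_flat_kbasis //; apply: can_inj lift_eltK.
move=> z; rewrite mem_kbasis; apply/and3P/mapP => [[zj /eqP zd zM]|[x]].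
  have zE : z = emb (unlift_elt z).
    rewrite [LHS]surjective_pairing; congr (_, _); apply/mnmP=> i.
    case: (unliftP ord0 i) => [k|] ->; first by rewrite homog_monE mnmE.
    rewrite homog_mon0 -zd addKn [mdeg z.2]mdegE big_ord_recl mdegE.
    by under [X in (_ - X)%N]eq_bigr do rewrite mnmE; rewrite addnK.
  exists (unlift_elt z) => //; rewrite mem_flat_kbasis /= zj /=; apply/andP; split.
    rewrite /weight -zd /= leq_add2l mdegE [mdeg z.2]mdegE big_ord_recl.
    by under eq_bigr do rewrite mnmE; rewrite leq_addl.
  apply/implyP => j0; move: zM; rewrite j0 /=; apply: contra => zM.
  apply/mapP; exists (unlift_elt z).2 => //; rewrite [in LHS]zE /=.
  by move: zj; rewrite (eqP j0) cards_eq0 => /eqP ->; rewrite /esum big_set0 subn0.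
rewrite mem_flat_kbasis => /and3P[xj xd xM] ->; rewrite /= xj; split=> //.
  have := xd; rewrite /weight => xd'.
  by rewrite mdeg_homog; [apply/eqP; lia | lia].
apply/implyP => j0; move: xM; rewrite j0 /=; apply: contra => /mapP[m mM].
move: xj; rewrite (eqP j0) cards_eq0 => /eqP ->; rewrite /esum big_set0 subn0.
by move/homog_mon_inj => ->.
Qed.

Definition hom_pivot z := is_pivot d (unlift_elt z).
Definition all_pivots j := flat (fun t => pivots d (is_pivot d) t (MT t) j).
Definition all_targets j := flat (fun t => targets d (is_pivot d) t (MT t) j).

Lemma perm_pivots j : perm_eq (pivots d hom_pivot delta MH j)
  [seq emb x | x <- all_pivots j].
Proof.
apply: (perm_trans (perm_filter _ (kbasis_hom j))); rewrite filter_map.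
rewrite (eq_filter (a2 := is_pivot d)) => [|x]; last by rewrite /= /hom_pivot lift_eltK.
by rewrite filter_flatten -map_comp.
Qed.

Lemma perm_targets j : perm_eq (targets d hom_pivot delta MH j)
  [seq emb x | x <- all_targets j].
Proof.
apply: (perm_trans (perm_filter _ (kbasis_hom j))); rewrite filter_map.
rewrite (eq_filter (a2 := fun x => ~~ ((0 < j)%N && is_pivot d x))) => [|x].
  by rewrite filter_flatten -map_comp.
by rewrite /= /hom_pivot lift_eltK.
Qed.

Lemma weight_pivots t S j x : x \in pivots d (is_pivot d) t S j -> wt x = t.
Proof. by rewrite mem_filter mem_kbasis => /and4P[_ _ /eqP]. Qed.

Lemma weight_targets t S j x : x \in targets d (is_pivot d) t S j -> wt x = t.
Proof. by rewrite mem_filter mem_kbasis => /and4P[_ _ /eqP]. Qed.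

Lemma weight_all_pivots j x : x \in all_pivots j -> (wt x <= delta)%N.
Proof. by case/flatten_mapP => t; rewrite mem_iota add0n ltnS => td /weight_pivots ->. Qed.

(** The minor of the homogenized complex with both bases listed by increasing weight, which displays
    its blocks. *)
Definition affine_minor j :=
  sdet kbT (size (all_pivots j.+1)) (@affine_entry K n d) (all_pivots j.+1) (all_targets j).

Lemma pivot_minor_hom j :
    size (pivots d hom_pivot delta MH j.+1) = size (targets d hom_pivot delta MH j) ->
  eq_sign (pivot_minor fH d hom_pivot delta MH j) (affine_minor j).
Proof.
move=> szE; apply: (eq_sign_trans
  (sdet_perm kbH _ erefl (esym szE) (perm_pivots j.+1) (perm_targets j))).
have szp : size (pivots d hom_pivot delta MH j.+1) = size (all_pivots j.+1).
  by rewrite (perm_size (perm_pivots _)) size_map.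
have szt : size (all_targets j) = size (all_pivots j.+1).
  by rewrite -szp szE (perm_size (perm_targets _)) size_map.
rewrite szp (sdet_map kbT) // (eq_in_sdet kbT (E' := @affine_entry K n d)) //.
  exact: eq_sign_refl.
by move=> x y xp _; rewrite koszul_entry_hom // (weight_all_pivots xp).
Qed.

Lemma size_all j : (forall t, (t <= delta)%N ->
    size (pivots d (is_pivot d) t (MT t) j.+1) = size (targets d (is_pivot d) t (MT t) j)) ->
  size (pivots d hom_pivot delta MH j.+1) = size (targets d hom_pivot delta MH j).
Proof.
move=> szE; rewrite (perm_size (perm_pivots _)) (perm_size (perm_targets _)) !size_map.
rewrite !size_flatten /shape -!map_comp; congr sumn; apply/eq_in_map => t.
by rewrite mem_iota add0n ltnS => /szE.
Qed.

(** No entry raises the weight, so the matrix is block lower triangular; within one weight the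
    entries are those of the top parts. *)
Lemma affine_minor_prod j : (forall t, (t <= delta)%N ->
    size (pivots d (is_pivot d) t (MT t) j.+1) = size (targets d (is_pivot d) t (MT t) j)) ->
  affine_minor j
  = \prod_(t < delta.+1) pivot_minor fT d (is_pivot d) t (MT t) j.
Proof.
move=> szE; rewrite /affine_minor /all_pivots /all_targets sdet_flatten.
- rewrite -[iota _ _]/(index_iota 0 delta.+1) big_mkord; apply: eq_bigr => t _.
  apply: eq_in_sdet => //; first by rewrite -szE // -ltnS.
  by move=> x y /weight_pivots xt /weight_targets yt; rewrite affine_entry_top ?xt.
- by move=> t; rewrite add0n ltnS => /szE.
- move=> t t' tt' _ x y /weight_pivots xt /weight_targets yt.
  by apply: affine_entry_lt; rewrite xt yt.
Qed.

Lemma minor_prod j : (forall t, (t <= delta)%N ->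
    size (pivots d (is_pivot d) t (MT t) j.+1) = size (targets d (is_pivot d) t (MT t) j)) ->
  eq_sign (pivot_minor fH d hom_pivot delta MH j)
          (\prod_(t < delta.+1) pivot_minor fT d (is_pivot d) t (MT t) j).
Proof.
by move=> szE; rewrite -affine_minor_prod //; apply/pivot_minor_hom/size_all.
Qed.

(** Inherited from the homogenized complex, whose consecutive maps compose to zero by exactness:
    between elements of weight [t] only intermediate elements of weight [t] contribute. *)
Lemma kmx_sqr_top j t : (t <= delta)%N -> koszul_exact fH d delta MH ->
  kmx fT d t (MT t) j.+1 *m kmx fT d t (MT t) j = 0.
Proof.
case: j => [|j] td exH; first by rewrite kmx0 mulmx0.
have sqH : kmx fH d delta MH j.+2 *m kmx fH d delta MH j.+1 = 0.
  by apply/sub_kermxP; rewrite (eqmxP (kmx_exact exH j.+1)).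
apply/kmx_sqr => x z xb zb.
have wx : wt x = t by move: xb; rewrite mem_kbasis => /and3P[_ /eqP].
have wz : wt z = t by move: zb; rewrite mem_kbasis => /and3P[_ /eqP].
have lift_mem i y : y \in kbasis d t (MT t) i -> emb y \in kbasis d delta MH i.
  move=> yb; rewrite (perm_mem (kbasis_hom _)) map_f //; apply/flatten_mapP.
  by exists t => //; rewrite mem_iota add0n ltnS.
have /kmx_sqr/(_ (emb x) (emb z)) := sqH.
rewrite !lift_mem // => /(_ isT isT).
rewrite (perm_big _ (kbasis_hom j.+1)) big_map big_flatten big_map.
rewrite (bigD1_seq t) ?iota_uniq ?mem_iota ?add0n ?ltnS //=.
rewrite [X in _ + X]big1_seq ?addr0.
  move=> E; rewrite -[RHS]E; apply: eq_big_seq => y yb.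
  have wy : wt y = t by move: yb; rewrite mem_kbasis => /and3P[_ /eqP].
  by rewrite !koszul_entry_hom ?wx ?wy // !affine_entry_top ?wx ?wy ?wz.
(* An intermediate element of another weight would have to be reached or left by an entry that
   raises the weight. *)
move=> t' /andP[t't _]; apply: big1_seq => y /andP[_ yb].
have wy : wt y = t' by move: yb; rewrite mem_kbasis => /and3P[_ /eqP].
rewrite koszul_entry_hom ?wx //; case: (ltngtP t' t) t't => // tt' _.
  rewrite koszul_entry_hom ?wy 1?ltnW ?(leq_trans tt') //.
  by rewrite [X in _ * X]affine_entry_lt ?mulr0 // wy wz.
by rewrite [X in X * _]affine_entry_lt ?mul0r // wx wy.
Qed.

End Decomposition.

(** * Generic monomial bases *)

Section GenericBases.
Variables (K : fieldType) (n : nat) (d : 'I_n -> nat) (M : seq 'X_{1..n}).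
Hypotheses (d_gt0 : forall i, (0 < d i)%N) (uniqM : uniq M).
Hypothesis sizeM : size M = (\prod_(i < n) d i)%N.
Local Notation CR := (CR K d).
Local Notation delta := (deltaM M).
Local Notation MH := [seq homog_mon delta m | m <- M].
Local Notation MT t := [seq m <- M | mdeg m == t].
Local Notation fH := (fhom K d).
Local Notation fT := (ftop K d).
Local Notation Hmin := (pivot_minor fH d (@hom_pivot n d) delta MH).
Local Notation Tmin t := (pivot_minor fT d (is_pivot d) t (MT t)).
Local Notation gl := (grade_lower (K := K) (@top_coef n d)).

Definition top_only (p : CR) := gl p = p%:P.

Lemma depends_only_on_topP p : depends_only_on_top p <-> top_only p.
Proof. by apply: iff_sym; apply: grade_lowerP. Qed.

Lemma top_only_prod (I : Type) (r : seq I) (P : pred I) (F : I -> CR) :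
  (forall i, P i -> top_only (F i)) -> top_only (\prod_(i <- r | P i) F i).
Proof.
by move=> FP; rewrite /top_only !rmorph_prod; apply: eq_bigr => i /FP.
Qed.

Lemma top_only_eq_sign (p q : CR) : eq_sign p q -> top_only q -> top_only p.
Proof.
move=> [e ->] tq; rewrite /top_only !rmorphM !rmorph_sign; congr (_ * _); exact: tq.
Qed.

Lemma top_only_factor (p q a : CR) :
  eq_sign (p * q) a -> a != 0 -> top_only a -> top_only p.
Proof.
move=> pqa a0 ta; apply: (@grade_lower_factor _ _ _ _ q).
  by rewrite (eq_sign_eq0 pqa).
exact: top_only_eq_sign pqa ta.
Qed.

Lemma top_only_det m (B : 'M[CR]_m) : (forall i j, top_only (B i j)) -> top_only (\det B).
Proof.
move=> BP; rewrite /top_only -!det_map_mx; congr (\det _).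
by apply/matrixP=> i j; rewrite !mxE; apply: BP.
Qed.

Lemma top_only_Tmin t j : top_only (Tmin t j).
Proof. by apply: top_only_det => a b; rewrite mxE; apply: grade_lower_top. Qed.

(** Cayley's formula exhibits [D] as a factor of a nonzero product of minors in the top
    coefficients. *)
Lemma top_only_subres t S D : is_subres fT d t S D -> D != 0 -> top_only D.
Proof.
case=> [[_ [sel [_ selP DE]]] D0|[_ ->]]; last by rewrite eqxx.
have minor_top j : top_only (kminor fT d t S sel j).
  by apply: top_only_det => a b; rewrite mxE kentE; apply: grade_lower_top.
have nz (Q : pred nat) : \prod_(1 <= j < n.+2 | Q j) kminor fT d t S sel j != 0.
  rewrite prodf_seq_neq0; apply/allP => j; rewrite mem_index_iota => jb.
  by apply/implyP => _; case: (selP j jb).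
apply: (top_only_factor (q := \prod_(1 <= j < n.+2 | ~~ odd j) kminor fT d t S sel j)
  (a := \prod_(1 <= j < n.+2 | odd j) kminor fT d t S sel j)) (nz odd) _.
  by exists false; rewrite mul1r; exact: DE.
exact: top_only_prod.
Qed.

Lemma Hmin_prod j : (0 < j)%N -> eq_sign (Hmin j) (\prod_(t < delta.+1) Tmin t j).
Proof. by move=> j0; apply: minor_prod => // t _; apply: size_pivots. Qed.

Lemma Hmin_neq0 j : (0 < j)%N -> Hmin j != 0.
Proof.
move=> j0; rewrite (eq_sign_eq0 (Hmin_prod j0)).
by apply/prodf_neq0 => t _; apply: top_pivot_minor_neq0.
Qed.

Lemma top_only_Hmin j : (0 < j)%N -> top_only (Hmin j).
Proof.
move=> /Hmin_prod/top_only_eq_sign; apply; apply: top_only_prod => t _.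
exact: top_only_Tmin.
Qed.

Lemma size_MT t :
  (size (pivots d (is_pivot d) t (MT t) 1) == size (targets d (is_pivot d) t (MT t) 0))
  = (count (fun m => mdeg m == t) M == count (in_box d) (mons n t)).
Proof.
rewrite size_pivots1 ?filter_uniq // ?size_filter // => m.
by rewrite mem_filter => /andP[/eqP].
Qed.

Section NonzeroDelta.
Variable Delta : CR.
Hypotheses (DeltaP : is_subres fH d delta MH Delta) (Delta0 : Delta != 0).

Lemma Delta_exact : koszul_exact fH d delta MH.
Proof. by case: DeltaP => [[]|[_ D0]] //; move: Delta0; rewrite D0 eqxx. Qed.

Lemma Delta_pivot :
  [/\ size (pivots d (@hom_pivot n d) delta MH 1)
      = size (targets d (@hom_pivot n d) delta MH 0),
      Hmin 0 != 0
    & eq_sign (Delta * \prod_(0 <= j < n.+1 | odd j) Hmin j)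
              (\prod_(0 <= j < n.+1 | ~~ odd j) Hmin j)].
Proof.
case: (subres_pivot (p := @hom_pivot n d) Delta_exact DeltaP) => [j /andP[j0 _]|sz m0 E].
  split; last exact: Hmin_neq0.
  by apply: size_all => // t _; apply: size_pivots.
by split=> //; apply: m0.
Qed.

Lemma even_Hmin_neq0 : \prod_(0 <= j < n.+1 | ~~ odd j) Hmin j != 0.
Proof.
rewrite prodf_seq_neq0; apply/allP => -[|j] _; apply/implyP => _.
  by case: Delta_pivot.
exact: Hmin_neq0.
Qed.

(* Setting the lower coefficients to 0 makes the matrix block diagonal. *)
Lemma card_of_top_only : top_only Delta -> forall t, (t <= delta)%N ->
  count (fun m => mdeg m == t) M = count (in_box d) (mons n t).
Proof.
move=> tD t td; case: Delta_pivot => sz1 H0 DE.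
(* [Hmin 0] is a factor of the even product, which by Cayley's formula is [Delta] times odd minors,
   and these involve only top coefficients. *)
have tH0 : top_only (Hmin 0).
  have tE : top_only (\prod_(0 <= j < n.+1 | ~~ odd j) Hmin j).
    apply: top_only_eq_sign (eq_sign_sym DE) _; rewrite /top_only !rmorphM.
    congr (_ * _); rewrite //; apply: top_only_prod => -[//|j] _; exact: top_only_Hmin.
  move: tE even_Hmin_neq0; rewrite big_ltn_cond //= => tE E0.
  exact: top_only_factor (eq_sign_refl _) E0 tE.
have Haff := pivot_minor_hom K uniqM sz1.
have taff := top_only_eq_sign (eq_sign_sym Haff) tH0.
have aff0 : affine_minor K d M 0 != 0 by rewrite -(eq_sign_eq0 Haff).
(* Having only top coefficients, the minor equals its value at T = 0, where the entries between
   different weights vanish. *)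
have affE : affine_minor K d M 0 = sdet (kb0 n n) (size (all_pivots d M 1))
    (fun x y => (gl (affine_entry K d x y)).[0]) (all_pivots d M 1) (all_targets d M 0).
  apply: etrans (grade_lower_sdet0 _ _ _ _ _ _).
  by apply: etrans (esym (hornerC _ 0)) (congr1 (fun p => p.[0]) (esym taff)).
rewrite affE in aff0.
have szR : size (all_targets d M 0) = size (all_pivots d M 1).
  move: sz1; rewrite (perm_size (perm_pivots d uniqM 1)).
  by rewrite (perm_size (perm_targets d uniqM 0)) !size_map.
have cnt (p : pred ({set 'I_n} * 'X_{1..n})) :
    (forall x y, p x -> ~~ p y -> weight d x != weight d y) ->
    (count p (all_pivots d M 1) <= count p (all_targets d M 0))%N.
  move=> pw; apply: (sdet_neq0_count erefl szR aff0) => x y _ _ px py.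
  by apply: grade_lower_entry0; apply: pw.
(* Neither the block of weight [t] nor the rest has more rows than columns; as the whole matrix is
   square, both are square. *)
have le1 := cnt (fun x => weight d x == t).
have le2 := cnt (fun x => weight d x != t).
apply/eqP; rewrite -size_MT; apply/eqP.
have ti : t \in iota 0 delta.+1 by rewrite mem_iota add0n ltnS.
rewrite -(count_flatten_key (w := weight d)
  (F := fun t => pivots d (is_pivot d) t (MT t) 1) (iota_uniq 0 delta.+1) ti);
  last by move=> t' x /weight_pivots ->.
rewrite -(count_flatten_key (w := weight d)
  (F := fun t => targets d (is_pivot d) t (MT t) 0) (iota_uniq 0 delta.+1) ti);
  last by move=> t' x /weight_targets ->.
apply/eqP; rewrite eqn_leq le1 => [|x y /eqP ->]; last by rewrite eq_sym.
rewrite -(leq_add2r (count (fun x => weight d x != t) (all_pivots d M 1))).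
rewrite count_predC -szR -(count_predC (fun x => weight d x == t) (all_targets d M 0)).
rewrite leq_add2l; by apply: le2 => x y xt; rewrite negbK => /eqP ->.
Qed.

Lemma mdeg_delta m : m \in M -> (mdeg m <= delta)%N.
Proof. by move=> mM; apply: leq_bigmax_seq. Qed.

(** Up to [delta] this is [card_of_top_only]. Beyond it [M] has no monomials, and neither has the
    box, whose part of degree at most [delta] already has [d_1 ... d_n] elements. *)
Lemma hilbert_of_top_only : top_only Delta -> forall t, (t <= rho d)%N ->
  (count (fun m => mdeg m == t) M)%:Z = hnum d t.
Proof.
move=> tD t tr; rewrite hnum_box; congr (Posz _).
have [td|td] := leqP t delta; first exact: card_of_top_only.
have -> : count (fun m => mdeg m == t) M = 0%N.
  apply/eqP; rewrite -leqn0 leqNgt -has_count; apply/hasPn => m /mdeg_delta md.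
  by apply: contraTN td => /eqP <-; rewrite -leqNgt.
have S1 : (\sum_(t < delta.+1) count (in_box d) (mons n t) = \prod_(i < n) d i)%N.
  rewrite -sizeM.
  rewrite -(eq_bigr _ (fun (t : 'I_delta.+1) _ =>
                         card_of_top_only tD (ltn_ord t : (t <= delta)%N))).
  rewrite sum_count_lt; apply/eqP; rewrite -all_count; apply/allP => m mM.
  by rewrite ltnS mdeg_delta.
have := sum_box d_gt0 (ltnSn (rho d)); rewrite -S1.
rewrite -!(big_mkord xpredT (fun t => count (in_box d) (mons n t))).
have dr : (delta.+1 <= (rho d).+1)%N by rewrite ltnS ltnW // (leq_trans td).
rewrite (big_cat_nat (leq0n _) dr) /= => /eqP; rewrite -[X in _ == X]addn0 eqn_add2l.
rewrite sum_nat_seq_eq0 => /allP/(_ t); rewrite mem_index_iota td ltnS tr => /(_ isT).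
by move/eqP.
Qed.

(** * Factorization of the subresultant under the Hilbert condition *)

Hypothesis hilbM : forall t, (t <= rho d)%N ->
  (count (fun m => mdeg m == t) M)%:Z = hnum d t.

(** The prescribed counts up to [rho d] already sum to the size of [M], so no degree is larger; the
    Hilbert number at [rho d] is 1, so that degree is attained. *)
Lemma delta_rho : delta = rho d.
Proof.
have cE t : (t <= rho d)%N -> count (fun m => mdeg m == t) M = count (in_box d) (mons n t).
  by move/hilbM; rewrite hnum_box => -[].
apply/eqP; rewrite eqn_leq; apply/andP; split.
  apply/bigmax_leqP_seq => m mM _.
  have : all (fun m => (mdeg m < (rho d).+1)%N) M.
    rewrite all_count -sum_count_lt sizeM -(sum_box d_gt0 (ltnSn (rho d))).
    by apply/eqP/eq_bigr => t _; apply: cE; rewrite -ltnS.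
  by move/allP/(_ m mM).
have : has (fun m => mdeg m == rho d) M.
  by rewrite has_count; have := hilbM (leqnn _); rewrite hnum_rho // => -[->].
by case/hasP => m mM /eqP <-; apply: mdeg_delta.
Qed.

Lemma size_pivots_all t j : (t <= delta)%N ->
  size (pivots d (is_pivot d) t (MT t) j.+1) = size (targets d (is_pivot d) t (MT t) j).
Proof.
rewrite delta_rho => td; case: j => [|j]; last exact: size_pivots.
by apply/eqP; rewrite size_MT; have := hilbM td; rewrite hnum_box => -[->].
Qed.

Lemma Hmin_prod_all j : eq_sign (Hmin j) (\prod_(t < delta.+1) Tmin t j).
Proof. by apply: minor_prod => // t; apply: size_pivots_all. Qed.

(** For [j = 0] these are the factors of the nonzero minor [Hmin 0]; for [j > 0] the specialization
    to pure powers applies. *)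
Lemma Tmin_neq0 t j : (t <= delta)%N -> Tmin t j != 0.
Proof.
case: j => [|j] td; last exact: top_pivot_minor_neq0.
have [_ + _] := Delta_pivot; rewrite (eq_sign_eq0 (Hmin_prod_all 0)).
by rewrite -ltnS in td; move/prodf_neq0/(_ (Ordinal td) isT).
Qed.

Lemma top_exact t : (t <= delta)%N -> koszul_exact fT d t (MT t).
Proof.
move=> td; apply: (koszul_exact_minors (sel := pivot_sel d (is_pivot d) t (MT t))).
- by move=> j; apply: kmx_sqr_top td Delta_exact.
- exact: krows_pivot0.
- case=> // j _; rewrite size_krows_pivot size_kcols_pivot kminor_pivot ?size_pivots_all //.
  by split=> //; apply: Tmin_neq0.
Qed.

(** All blocks being square, every [Hmin j] involves only top coefficients, and [Delta] divides a
    nonzero product of them. *)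
Lemma top_only_Delta : top_only Delta.
Proof.
have [_ _ DE] := Delta_pivot; apply: top_only_factor DE even_Hmin_neq0 _.
apply: top_only_prod => j _; apply: top_only_eq_sign (Hmin_prod_all j) _.
by apply: top_only_prod => t _; apply: top_only_Tmin.
Qed.

Variable Dt : nat -> CR.
Hypothesis DtP : forall t, (t <= rho d)%N -> is_subres fT d t (MT t) (Dt t).

Lemma Dt_pivot t : (t <= delta)%N ->
  eq_sign (Dt t * \prod_(0 <= j < n.+1 | odd j) Tmin t j)
          (\prod_(0 <= j < n.+1 | ~~ odd j) Tmin t j).
Proof.
move=> td; have Dtt : is_subres fT d t (MT t) (Dt t) by apply: DtP; rewrite -delta_rho.
case: (subres_pivot (p := is_pivot d) (top_exact td) Dtt) => // j _.
by split; [apply: size_pivots_all | apply: Tmin_neq0].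
Qed.

(** Below all the [d i] the modules [K_j] with [j > 0] are zero and every minor is empty; hence the
    product may start at the least [d i]. *)
Lemma Dt_low t : (t <= delta)%N -> ~~ [exists i, (d i <= t)%N] -> eq_sign (Dt t) 1.
Proof.
move=> td /existsPn lowt.
have piv0 j : pivots d (is_pivot d) t (MT t) j.+1 = [::].
  apply/nilP; rewrite /nilp size_filter -leqn0 leqNgt -has_count; apply/hasPn => x.
  rewrite mem_kbasis => /and3P[/eqP xj /eqP xt _].
  have /card_gt0P[i xi] : (0 < #|x.1|)%N by rewrite xj.
  by have := lowt i; rewrite -xt (esum_setD1 d xi) -addnA leq_addr.
have m1 j : Tmin t j = 1 by rewrite /pivot_minor piv0 /sdet det_mx00.
have := Dt_pivot td; rewrite !big1 ?mulr1 // => j _; exact: m1.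
Qed.

(** Cayley's formula for [Delta], with each minor split by weight, is the product over [t] of the
    formulas for [Dt t]; the nonzero odd minors cancel. *)
Lemma Delta_factor :
  eq_sign Delta (\prod_(t < (rho d).+1 | [exists i, (d i <= t)%N]) Dt t).
Proof.
have [_ _ DE] := Delta_pivot.
have HT (Q : pred nat) : eq_sign (\prod_(0 <= j < n.+1 | Q j) Hmin j)
    (\prod_(t < delta.+1) \prod_(0 <= j < n.+1 | Q j) Tmin t j).
  by rewrite exchange_big /=; apply: eq_sign_prod => j _; apply: Hmin_prod_all.
have Dall : eq_sign Delta (\prod_(t < delta.+1) Dt t).
  apply: (@eq_sign_mulIf _ (\prod_(t < delta.+1) \prod_(0 <= j < n.+1 | odd j) Tmin t j)).
    apply/prodf_neq0 => t _; rewrite prodf_seq_neq0; apply/allP => j _.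
    by apply/implyP => _; apply: Tmin_neq0; rewrite -ltnS.
  apply: eq_sign_trans (eq_signM (eq_sign_refl _) (eq_sign_sym (HT odd))) _.
  apply: (eq_sign_trans DE); apply: (eq_sign_trans (HT _)); rewrite -big_split /=.
  apply/eq_sign_sym; apply: eq_sign_prod => t _; apply: Dt_pivot.
  by rewrite -ltnS.
apply: (eq_sign_trans Dall); rewrite -delta_rho [X in eq_sign _ X]big_mkcond /=.
apply: eq_sign_prod => t _; case: ifPn => [_|lowt]; first exact: eq_sign_refl.
by apply: Dt_low; rewrite // -ltnS.
Qed.

End NonzeroDelta.
End GenericBases.

(** * Equivalence and factorization for generic systems *)

Theorem theorem5 (K : fieldType) (n : nat) (d : 'I_n -> nat)
    (M : seq 'X_{1..n}) (Res Delta : CR K d) (Dt : nat -> CR K d) :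
  (0 < n)%N ->
  (forall i, 0 < d i)%N ->
  uniq M ->
  size M = (\prod_(i < n) d i)%N ->
  (* Res = Res_{d_1..d_n}(f_{1d_1},...,f_{nd_n}) (up to sign) *)
  is_subres (ftop K d) d (rho d).+1 [::] Res ->
  (* Delta = Delta^delta_{M_delta} w.r.t. f_1^0,...,f_n^0 (up to sign) *)
  is_subres (fhom K d) d (deltaM M) [seq homog_mon (deltaM M) m | m <- M] Delta ->
  (* Dt t = D^t_{M cap K[x]_t} w.r.t. f_{1d_1},...,f_{nd_n} (up to sign) *)
  (forall t, (t <= rho d)%N ->
     is_subres (ftop K d) d t [seq m <- M | mdeg m == t] (Dt t)) ->
  Res * Delta != 0 ->
  (depends_only_on_top (Res * Delta) <->
     (forall t, (t <= rho d)%N ->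
        (count (fun m => mdeg m == t) M)%:Z = hnum d t)) /\
  ((forall t, (t <= rho d)%N ->
        (count (fun m => mdeg m == t) M)%:Z = hnum d t) ->
   Delta = \prod_(t < (rho d).+1 | [exists i, d i <= t]%N) Dt t \/
   Delta = - \prod_(t < (rho d).+1 | [exists i, d i <= t]%N) Dt t).
Proof.
move=> n_gt0 d_gt0 uniqM sizeM ResP DeltaP DtP RD0.
have [Res0 Delta0] : Res != 0 /\ Delta != 0.
  by apply/andP; rewrite -negb_or -mulf_eq0.
split; last first.
  by move=> hilbM; apply: eq_signP (Delta_factor d_gt0 uniqM sizeM DeltaP Delta0 hilbM DtP).
rewrite depends_only_on_topP; split=> [tRD|hilbM].
  apply: (hilbert_of_top_only d_gt0 uniqM sizeM DeltaP Delta0).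
  apply: (top_only_factor (q := Res) _ RD0 tRD).
  by rewrite mulrC; apply: eq_sign_refl.
(* As a subresultant of the top parts, in degree [rho + 1], [Res] involves only their
   coefficients. *)
have tR := top_only_subres ResP Res0.
have tD := top_only_Delta d_gt0 uniqM sizeM DeltaP Delta0 hilbM.
by rewrite /top_only !rmorphM; congr (_ * _).
Qed.
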